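(* In the setting of the context, assume that: (1) $\varphi$ is $C^2$-strictly decomposable at $\bar x$ for $\bar\lambda\in\mathcal{Q}$ with decomposition pair $(\sigma_{\mathcal{Q}},F)$, where $\bar v=\mathcal{D}F(\bar x)^\top\bar\lambda$; (2) $\mathcal{Q}$ has the outer second-order tangent path property at $\bar\lambda$; (3) for every pair $(x,\lambda)$ in a neighborhood of $(\bar x,\bar\lambda)$ satisfying $F(x)\in\mathrm{ri}(\mathcal{N})$ and $\lambda\in\mathrm{ri}(\mathcal{G})$, the proximity operator $\mathrm{prox}_{\tau\varphi}$ is differentiable at $x+\tau\mathcal{D}F(x)^\top\lambda$, where $\mathcal{N}:=N_{\mathcal{Q}}(\bar\lambda)$ and $\mathcal{G}$ is the smallest exposed face of $\mathcal{Q}$ containing $\bar\lambda$. Set $S:=\mathcal{D}F(\bar x)^{-1}N_{\mathcal{Q}}(\bar\lambda)$ and $Q:=\Pi_{\mathrm{aff}(S)}H(\bar x,\bar\lambda)\Pi_{\mathrm{aff}(S)}$. Then there exists a sequence $(x^k,v^k)\in\mathrm{gph}(\partial\varphi)$ with $(x^k,v^k)\to(\bar x,\bar v)$ such that $\varphi$ is twice epi-differentiable at $x^k$ for $v^k$, $\mathrm{d}^2\varphi(x^k|v^k)$ is generalized quadratic, and $$\Big(\operatorname*{e-lim}_{k\to\infty}\,\mathrm{d}^2\varphi(x^k|v^k)\Big)(w)=\langle w,Qw\rangle+\iota_{\mathrm{aff}(S)}(w)\quad\forall\,w\in\mathbb{R}^n.$$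
   Context: Setting: $f:\mathbb{R}^n\to\mathbb{R}$ is twice continuously differentiable, $\varphi:\mathbb{R}^n\to(-\infty,\infty]$ is proper, lower semicontinuous (lsc) and prox-bounded, $\psi=f+\varphi$, $0\in\partial\psi(\bar x)$, $\bar v=-\nabla f(\bar x)$, $\tau>0$. Standing assumption: $\varphi$ is globally prox-regular at $\bar x$ for $\bar v$ with constant $\rho$ and $\tau\rho<1$; i.e. $\varphi$ is locally lsc at $\bar x$ and there is $\epsilon>0$ such that $\varphi(x')\ge\varphi(x)+\langle v,x'-x\rangle-\frac{\rho}{2}\|x'-x\|^2$ for all $x'\in\mathbb{R}^n$ whenever $\|x-\bar x\|<\epsilon$, $\|v-\bar v\|<\epsilon$, $v\in\partial\varphi(x)$, $\varphi(x)<\varphi(\bar x)+\epsilon$. Here $\partial$ is the limiting subdifferential. The proximity operator is $\mathrm{prox}_{\tau\varphi}(x)\in\mathrm{argmin}_y\,\varphi(y)+\frac{1}{2\tau}\|x-y\|^2$; it is single-valued and Lipschitz continuous near $\bar x+\tau\bar v$. Decomposability: $\varphi$ is $C^2$-decomposable at $\bar x\in\mathrm{dom}(\varphi)$ with pair $(\varphi_d,F)$ if there is an open neighborhood $U$ of $\bar x$ with $\varphi(x)=\varphi(\bar x)+\varphi_d(F(x))$ for $x\in U$, where $F:\mathbb{R}^n\to\mathbb{R}^m$ is twice continuously differentiable on $U$ with $F(\bar x)=0$; $\varphi_d=\sigma_{\mathcal{Q}}$ is the (proper) support function of a closed convex set $\mathcal{Q}\subseteq\mathbb{R}^m$; and Robinson's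 constraint qualification $0\in\mathrm{int}\{\mathcal{D}F(\bar x)\mathbb{R}^n-\mathrm{dom}(\varphi_d)\}$ holds. It is $C^2$-strictly decomposable at $\bar x$ for $\bar\lambda\in\mathcal{Q}$ if, in addition, $\mathcal{D}F(\bar x)\mathbb{R}^n-N_{\mathcal{Q}}(\bar\lambda)=\mathbb{R}^m$. Tangent objects: $T_{\mathcal{Q}}(\lambda)$, $N_{\mathcal{Q}}(\lambda)$ are the tangent and normal cones of the convex set $\mathcal{Q}$; $\mathrm{lin}(\cdot)$ is the lineality space; the outer second-order tangent set is $T^2_{\mathcal{Q}}(\lambda,p)=\{r:\exists\,t_k\downarrow0,\ \mathrm{dist}(\lambda+t_kp+\frac{t_k^2}{2}r,\mathcal{Q})=o(t_k^2)\}$; $\mathrm{dist}(0,\emptyset)=\infty$. Convergence of sets is Painlevé–Kuratowski convergence. Outer second-order tangent path property: $\mathcal{Q}$ has it at $\bar\lambda\in\mathcal{Q}$ if there are $M>0$ and a neighborhood $V$ of $\bar\lambda$ such that for all $\lambda\in\mathcal{Q}\cap V$: (i) one can select a linear subspace $L(\lambda)\subseteq\mathrm{lin}(T_{\mathcal{Q}}(\lambda))$ such that $L(\lambda)\to\mathrm{lin}(T_{\mathcal{Q}}(\bar\lambda))$ as $\lambda\to\bar\lambda$; (ii) for all $p\in L(\lambda)$ with $\|p\|=1$, $\mathrm{dist}(0,T^2_{\mathcal{Q}}(\lambda,p))<M$. Exposed faces: an exposed face of $\mathcal{Q}$ is a set of the form $\{y\in\mathcal{Q}:\langle x,y\rangle=\sigma_{\mathcal{Q}}(x)\}$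 with $x\ne0$; the smallest exposed face containing $\bar\lambda$ is the intersection of all exposed faces containing $\bar\lambda$ (taken to be $\mathcal{Q}$ itself if there are none). $\mathrm{ri}$ denotes relative interior. Second subderivative: $\mathrm{d}^2\theta(x|\alpha)(h)=\liminf_{t\downarrow0,\,\tilde h\to h}\Delta_t^2\theta(x|\alpha)(\tilde h)$ with $\Delta_t^2\theta(x|\alpha)(h)=\frac{\theta(x+th)-\theta(x)-t\langle\alpha,h\rangle}{\frac12t^2}$; $\theta$ is twice epi-differentiable at $x$ for $\alpha$ if the $\Delta_t^2\theta(x|\alpha)$ epi-converge as $t\downarrow0$. A function is generalized quadratic if it has the form $w\mapsto\langle w,Aw\rangle+\iota_L(w)$ with $A$ symmetric and $L$ a linear subspace. $(\operatorname{e-lim}_{k\to\infty}\theta_k)(w)=\theta(w)$ means $\liminf_k\theta_k(w^k)\ge\theta(w)$ for every $w^k\to w$ and $\limsup_k\theta_k(w^k)\le\theta(w)$ for some $w^k\to w$. Notation: $H(x,\lambda)=\sum_{i=1}^m\lambda_i\nabla^2F_i(x)$; $\mathcal{D}F(\bar x)^{-1}K=\{w:\mathcal{D}F(\bar x)w\in K\}$; $\iota$ indicator function; $\mathrm{aff}$ affine hull; $\Pi_L$ orthogonal projection matrix onto the subspace $L$. *)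

(* Defs.v *)
From HB Require Import structures.
From mathcomp Require Export all_boot all_order all_algebra.
From mathcomp Require Export all_classical all_reals all_analysis.
Export Order.TTheory GRing.Theory Num.Theory.
Export numFieldNormedType.Exports.
Set Implicit Arguments.
Unset Strict Implicit.
Unset Printing Implicit Defensive.
Local Open Scope classical_set_scope.
Local Open Scope ring_scope.

(* Vectors of R^n are rows 'rV[R]_n and matrices act on the right.  The library
   Jacobian is the transpose of the usual one, so that DF(x) w is w *m 'J F x
   and DF(x)^T l is l *m ('J F x)^T.  The library norm on 'rV[R]_n is the sup
   norm: it induces the right topology and the right notion of
   differentiability, but wherever a norm appears explicitly in the mathematics
   the Euclidean norm [enorm] below is used. *)

Section Euclidean.
Context {R : realType} {n : nat}.
Implicit Types (u v w x y : 'rV[R]_n) (A C L : set 'rV[R]_n).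

Definition dot u v : R := \sum_i u ord0 i * v ord0 i.

Definition enorm u : R := Num.sqrt (dot u u).

(* +oo when A is empty *)
Definition dist x A : \bar R := ereal_inf [set (enorm (x - a))%:E | a in A].

Definition ind A w : \bar R := if `[< A w >] then 0%E else +oo%E.

Definition affine_hull C : set 'rV[R]_n :=
  [set y | exists (k : nat) (a : 'I_k -> R) (x : 'I_k -> 'rV[R]_n),
     [/\ forall i, C (x i), \sum_i a i = 1 & y = \sum_i a i *: x i]].

Definition relint C : set 'rV[R]_n :=
  [set x | C x /\ \forall y \near x, affine_hull C y -> C y].

Definition is_orth_proj L (P : 'M[R]_n) :=
  forall w, L (w *m P) /\ (forall u, L u -> dot (w - w *m P) u = 0).

(* meaningful only when L is a linear subspace *)
Definition orth_proj L : 'M[R]_n := get (is_orth_proj L).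

Definition decr0 (t : nat -> R) := (forall k, 0 < t k) /\ t @ \oo --> (0 : R).

End Euclidean.

Section ConvexSets.
Context {R : realType} {m : nat}.
Implicit Types (l p r v w x y : 'rV[R]_m) (Q K : set 'rV[R]_m).

Definition support Q x : \bar R := ereal_sup [set (dot l x)%:E | l in Q].

Definition normal_cone Q l : set 'rV[R]_m :=
  [set v | Q l /\ forall y, Q y -> dot v (y - l) <= 0].

Definition tangent_cone Q l : set 'rV[R]_m :=
  [set w | exists (t : nat -> R) (w_ : nat -> 'rV[R]_m),
     [/\ decr0 t, w_ @ \oo --> w & forall k, Q (l + t k *: w_ k)]].

(* lineality space of a convex cone *)
Definition lineality K : set 'rV[R]_m := [set w | K w /\ K (- w)].

Definition tangent2 Q l p : set 'rV[R]_m :=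
  [set r | exists2 t : nat -> R, decr0 t &
     (((t k ^+ 2)^-1)%:E *
        dist (l + t k *: p + (t k ^+ 2 / 2) *: r) Q)%E @[k --> \oo] --> 0%E].

Definition exposed_face Q (G : set 'rV[R]_m) :=
  exists2 x, x != 0 & G = [set y | Q y /\ (dot x y)%:E = support Q x].

(* equal to Q when no exposed face contains l *)
Definition smallest_exposed_face Q l : set 'rV[R]_m :=
  Q `&` \bigcap_(G in [set G | exposed_face Q G /\ G l]) G.

(* Painleve-Kuratowski limits of L(x) as x -> a in D; x = a is allowed when
   a lies in D *)
Definition outer_limit (D : set 'rV[R]_m) (L : 'rV[R]_m -> set 'rV[R]_m)
    (a : 'rV[R]_m) : set 'rV[R]_m :=
  [set w | exists x_ w_ : nat -> 'rV[R]_m,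
     [/\ forall k, D (x_ k), x_ @ \oo --> a,
         forall k, L (x_ k) (w_ k) & w_ @ \oo --> w]].

Definition inner_limit (D : set 'rV[R]_m) (L : 'rV[R]_m -> set 'rV[R]_m)
    (a : 'rV[R]_m) : set 'rV[R]_m :=
  [set w | forall x_ : nat -> 'rV[R]_m,
     (forall k, D (x_ k)) -> x_ @ \oo --> a ->
     exists2 w_ : nat -> 'rV[R]_m,
       \forall k \near \oo, L (x_ k) (w_ k) & w_ @ \oo --> w].

Definition pk_cvg D L a K := outer_limit D L a = K /\ inner_limit D L a = K.

Definition tangent_path_property Q (lbar : 'rV[R]_m) :=
  exists (M : R) (V : set 'rV[R]_m) (L : 'rV[R]_m -> {vspace 'rV[R]_m}),
    [/\ 0 < M, nbhs lbar V,
        forall l, (Q `&` V) l ->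
          [set` L l] `<=` lineality (tangent_cone Q l),
        pk_cvg (Q `&` V) (fun l => [set` L l]) lbar
          (lineality (tangent_cone Q lbar)) &
        forall l p, (Q `&` V) l -> p \in L l -> enorm p = 1 ->
          (dist 0 (tangent2 Q l p) < M%:E)%E].

End ConvexSets.

Section Smooth.
Context {R : realType} {n : nat}.

Definition grad (g : 'rV[R]_n -> R) (x : 'rV[R]_n) : 'rV[R]_n :=
  \row_i 'D_(delta_mx ord0 i) g x.

Definition hess (g : 'rV[R]_n -> R) (x : 'rV[R]_n) : 'M[R]_n := 'J (grad g) x.

Definition C2_on (U : set 'rV[R]_n) (g : 'rV[R]_n -> R) :=
  forall x, U x ->
    [/\ differentiable g x, differentiable (grad g) x &
        {for x, continuous (hess g)}].

Definition hessL {m : nat} (F : 'rV[R]_n -> 'rV[R]_m)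
    (x : 'rV[R]_n) (l : 'rV[R]_m) : 'M[R]_n :=
  \sum_i l ord0 i *: hess (fun y => F y ord0 i) x.

End Smooth.

Section Variational.
Context {R : realType} {n : nat}.
Implicit Types (f g phi theta : 'rV[R]_n -> \bar R) (x v w h : 'rV[R]_n).

Definition proper phi :=
  (forall x, phi x != -oo%E) /\ (exists x, (phi x < +oo)%E).

Definition dom phi : set 'rV[R]_n := [set x | (phi x < +oo)%E].

Definition moreau_env (s : R) phi x : \bar R :=
  ereal_inf [set (phi y + ((2 * s)^-1 * enorm (x - y) ^+ 2)%:E)%E | y in setT].

Definition prox_bounded phi :=
  exists s x, 0 < s /\ (-oo < moreau_env s phi x)%E.

Definition argmin phi : set 'rV[R]_n := [set y | forall z, (phi y <= phi z)%E].

(* a selection of the argmin mapping *)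
Definition prox (tau : R) phi x : 'rV[R]_n :=
  get (argmin (fun y => (phi y + ((2 * tau)^-1 * enorm (x - y) ^+ 2)%:E)%E)).

Definition regular_subdiff phi x : set 'rV[R]_n :=
  [set v | phi x \is a fin_num /\
     forall e : R, 0 < e -> \forall y \near x,
       (phi x + (dot v (y - x) - e * enorm (y - x))%:E <= phi y)%E].

Definition limiting_subdiff phi x : set 'rV[R]_n :=
  [set v | phi x \is a fin_num /\
     exists x_ v_ : nat -> 'rV[R]_n,
       [/\ x_ @ \oo --> x, phi (x_ k) @[k --> \oo] --> phi x,
           forall k, regular_subdiff phi (x_ k) (v_ k) & v_ @ \oo --> v]].

Definition locally_lsc phi x :=
  exists2 e : R, 0 < e & forall a : \bar R, (a <= phi x + e%:E)%E ->
    closed [set y | enorm (y - x) <= e /\ (phi y <= a)%E].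

Definition globally_prox_regular phi (xbar vbar : 'rV[R]_n) (rho : R) :=
  locally_lsc phi xbar /\
  exists2 e : R, 0 < e & forall x v,
    enorm (x - xbar) < e -> enorm (v - vbar) < e ->
    limiting_subdiff phi x v -> (phi x < phi xbar + e%:E)%E ->
    forall x', (phi x + (dot v (x' - x) - rho / 2 * enorm (x' - x) ^+ 2)%:E
                <= phi x')%E.

(* second-order difference quotient Delta_t^2 theta (x | v) (h) *)
Definition diffquo2 theta x v (t : R) h : \bar R :=
  ((t ^+ 2 / 2)^-1%:E *
     (theta (x + t *: h)%R - theta x - (t * dot v h)%:E))%E.

Definition subderiv2 theta x v h : \bar R :=
  limf_einf (fun z : R * 'rV[R]_n => diffquo2 theta x v z.1 z.2)
    (filter_prod (0 : R)^'+ (nbhs h)).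

Definition epi_cvg (theta_ : nat -> 'rV[R]_n -> \bar R) theta :=
  forall w,
    (forall w_ : nat -> 'rV[R]_n, w_ @ \oo --> w ->
       (theta w <= limn_einf (fun k => theta_ k (w_ k)))%E) /\
    (exists2 w_ : nat -> 'rV[R]_n, w_ @ \oo --> w &
       (limn_esup (fun k => theta_ k (w_ k)) <= theta w)%E).

Definition twice_epi_differentiable theta x v :=
  exists g, forall t : nat -> R, decr0 t ->
    epi_cvg (fun k => diffquo2 theta x v (t k)) g.

Definition generalized_quadratic theta :=
  exists (A : 'M[R]_n) (L : {vspace 'rV[R]_n}), A^T = A /\
    forall w, theta w = ((dot w (w *m A))%:E + ind [set` L] w)%E.

End Variational.

Section Decomposable.
Context {R : realType} {n m : nat}.
Implicit Types (phi : 'rV[R]_n -> \bar R) (Q : set 'rV[R]_m)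
  (F : 'rV[R]_n -> 'rV[R]_m).

Definition C2_decomposable phi (xbar : 'rV[R]_n) Q F :=
  [/\ dom phi xbar,
      [/\ closed Q, convex_set Q & proper (support Q)],
      F xbar = 0,
      exists U : set 'rV[R]_n,
        [/\ open U, U xbar,
            forall i, C2_on U (fun x => F x ord0 i) &
            forall x, U x -> phi x = (phi xbar + support Q (F x))%E] &
      interior [set z | exists w y, dom (support Q) y /\
                          z = w *m 'J F xbar - y] 0].

Definition C2_strictly_decomposable phi xbar (lbar : 'rV[R]_m) Q F :=
  [/\ C2_decomposable phi xbar Q F, Q lbar &
      [set z | exists w y, normal_cone Q lbar y /\ z = w *m 'J F xbar - y]
        = setT].

End Decomposable.

(* Main.v *)
Require Import Defs.
From mathcomp Require Import ring lra.

(** Write [J] for the Jacobian of [F] at [xbar], [N] for the normal cone of [Q]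
    at [lbar] and [G] for the smallest exposed face of [Q] containing [lbar].
    The sequence is [v_ k = l_ k *m ('J F (x_ k))^T] with [F (x_ k)] in the
    relative interior of [N], [l_ k] in the relative interior of [G] and
    [(x_ k, l_ k)] tending to [(xbar, lbar)].  Four ideas carry the proof.

    First, the support function of [Q] is linear on [N]: every nonzero element
    of [N] exposes a face containing [lbar], so each [l] in [G] maximises every
    element of [N] over [Q] ([support_face]).  Hence [v_ k] is a regular
    subgradient at [x_ k], and along curves that [F] maps into [N] the function
    [phi] has the second-order expansion of the smooth function
    [dot (l_ k) (F x)].  Such curves exist because the constraint
    [F x *m C = 0], with [C] the cokernel of the span of [N], is metrically
    regular: this is what strict decomposability gives
    ([constraint_regularity], [feasible_path]).  The same argument produces the
    points [x_ k] themselves ([exists_near_relint]) and shows that the affine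
    hull of the critical set [S] is the kernel of [J *m C]
    ([affine_hull_critical]).

    Second, by prox-regularity with [tau * rho < 1] the point [x_ k] is the
    proximal point of [x_ k + tau *: v_ k].  The proximal points of the
    second-order difference quotients of [phi] are difference quotients of
    [prox tau phi], so differentiability of the latter makes them converge to a
    linear map.  That map is symmetric, being a limit of subgradients of convex
    functions, and the Moreau envelopes converge to a quadratic form.  This
    yields epi-convergence of the quotients to a generalized quadratic function
    ([prox_differentiable_epi]), which is then the second subderivative
    ([subderiv2_epi]).

    Third, comparing the support function with the linear form given by a point
    of [Q] bounds the second subderivatives from below.  The point [l_ k] alone
    gives the quadratic form of [hessL F (x_ k) (l_ k)].  Moving it along a curve
    of [Q] with velocity [p] and acceleration [a] adds
    [2 / c * dot p (w *m 'J F (x_ k)) + dot a (F (x_ k)) / c ^+ 2] for each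
    [c > 0] ([second_subderiv_lower]).  The path property supplies unit
    velocities approaching any direction orthogonal to [N], by the bipolar
    relation ([orth_normal_lineality]), with bounded accelerations.  Since
    [F (x_ k)] tends to [0], the second subderivatives tend to infinity at
    directions outside the affine hull of [S] ([second_subderiv_blowup]).

    Fourth, feasible curves bound the second subderivative at [x_ k] from above
    by the same quadratic form on the kernel of ['J F (x_ k) *m C]
    ([second_subderiv_upper]), and these kernels contain vectors converging to
    any prescribed vector of the kernel of [J *m C]
    ([cvg_kernel_directions]). *)

Set Implicit Arguments.
Unset Strict Implicit.
Unset Printing Implicit Defensive.
Local Open Scope classical_set_scope.
Local Open Scope ring_scope.

(** * Inner product and norms *)

Section Dot.
Context {R : realType} {n : nat}.
Implicit Types u v w : 'rV[R]_n.

Lemma dotE u v : dot u v = (u *m v^T) ord0 ord0.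
Proof. by rewrite mxE; apply: eq_bigr => i _; rewrite mxE. Qed.

Lemma dotC u v : dot u v = dot v u.
Proof. by apply: eq_bigr => i _; rewrite mulrC. Qed.

Lemma dotDl u v w : dot (u + v) w = dot u w + dot v w.
Proof. by rewrite !dotE mulmxDl mxE. Qed.

Lemma dotDr u v w : dot w (u + v) = dot w u + dot w v.
Proof. by rewrite !(dotC w) dotDl. Qed.

Lemma dotZl a u v : dot (a *: u) v = a * dot u v.
Proof. by rewrite !dotE -scalemxAl mxE. Qed.

Lemma dotZr a u v : dot u (a *: v) = a * dot u v.
Proof. by rewrite !(dotC u) dotZl. Qed.

Lemma dotNl u v : dot (- u) v = - dot u v.
Proof. by rewrite -scaleN1r dotZl mulN1r. Qed.

Lemma dotNr u v : dot u (- v) = - dot u v.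
Proof. by rewrite !(dotC u) dotNl. Qed.

Lemma dotBl u v w : dot (u - v) w = dot u w - dot v w.
Proof. by rewrite dotDl dotNl. Qed.

Lemma dotBr u v w : dot w (u - v) = dot w u - dot w v.
Proof. by rewrite dotDr dotNr. Qed.

Lemma dot0l u : dot 0 u = 0.
Proof. by rewrite dotE mul0mx mxE. Qed.

Lemma dot0r u : dot u 0 = 0.
Proof. by rewrite dotC dot0l. Qed.

Lemma dot_suml I (r : seq I) (P : pred I) (F : I -> 'rV[R]_n) v :
  dot (\sum_(i <- r | P i) F i) v = \sum_(i <- r | P i) dot (F i) v.
Proof.
by elim/big_rec2: _ => [|i x y _ <-]; rewrite ?dot0l ?dotDl.
Qed.

Definition dotlin := (dotDl, dotDr, dotNl, dotNr, dotZl, dotZr, dot0l, dot0r).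

Lemma dot_ge0 u : 0 <= dot u u.
Proof. by apply: sumr_ge0 => i _; rewrite -expr2 sqr_ge0. Qed.

Lemma dot_eq0 u : (dot u u == 0) = (u == 0).
Proof.
apply/eqP/eqP => [|->]; last exact: dot0l.
move/eqP; rewrite psumr_eq0 => [/allP h|i _]; last by rewrite -expr2 sqr_ge0.
apply/rowP => i; have := h i; rewrite mem_index_enum => /(_ isT).
by rewrite mulf_eq0 orbb mxE => /eqP.
Qed.

Lemma dot_eq0_all u : (forall v, dot u v = 0) -> u = 0.
Proof. by move=> /(_ u) /eqP; rewrite dot_eq0 => /eqP. Qed.

Lemma sqr_enorm u : enorm u ^+ 2 = dot u u.
Proof. by rewrite sqr_sqrtr// dot_ge0. Qed.

Lemma enorm_ge0 u : 0 <= enorm u.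
Proof. exact: sqrtr_ge0. Qed.

Lemma enormN u : enorm (- u) = enorm u.
Proof. by rewrite /enorm dotNl dotNr opprK. Qed.

Lemma enormZ a u : enorm (a *: u) = `|a| * enorm u.
Proof.
by rewrite /enorm dotZl dotZr mulrA -expr2 sqrtrM ?sqr_ge0// sqrtr_sqr.
Qed.

Lemma enorm_eq0 u : (enorm u == 0) = (u == 0).
Proof.
by rewrite -dot_eq0 sqrtr_eq0 le_eqVlt ltNge dot_ge0 orbF.
Qed.

Lemma dot_le u v : dot u v <= enorm u * enorm v.
Proof.
have [->|v0] := eqVneq v 0.
  by rewrite dot0r mulr_ge0// enorm_ge0.
have ev : 0 < enorm v by rewrite lt_neqAle enorm_ge0 andbT eq_sym enorm_eq0.
have : 0 <= dot (enorm v *: u - enorm u *: v) (enorm v *: u - enorm u *: v).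
  exact: dot_ge0.
rewrite !dotlin -!sqr_enorm (dotC v u).
have [u0|u0] := leP (enorm u) 0.
  have : enorm u = 0 by apply/eqP; rewrite eq_le u0 enorm_ge0.
  by move=> /eqP; rewrite enorm_eq0 => /eqP ->; rewrite dot0l mulr_ge0 ?enorm_ge0.
move=> h; have {h} : 0 <= 2 * (enorm u * enorm v) * (enorm u * enorm v - dot u v).
  by apply: le_trans h _; rewrite le_eqVlt; apply/orP; left; apply/eqP; ring.
by rewrite pmulr_rge0 ?subr_ge0// mulr_gt0// mulr_gt0.
Qed.

Lemma norm_entry_le u i : `|u ord0 i| <= `|u|.
Proof.
rewrite [leRHS]/Num.norm /= mx_normrE.
by rewrite (le_bigmax _ (fun j : 'I_1 * 'I_n => `|u j.1 j.2|) (ord0, i)).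
Qed.

Lemma dot_le_norm u v : `|dot u v| <= n%:R * (`|u| * `|v|).
Proof.
apply: (le_trans (ler_norm_sum _ _ _)).
apply: (@le_trans _ _ (\sum_(i < n) `|u| * `|v|)).
  by apply: ler_sum => i _; rewrite normrM ler_pM// norm_entry_le.
by rewrite sumr_const card_ord mulr_natl.
Qed.

Lemma norm_le_enorm u : `|u| <= enorm u.
Proof.
rewrite {1}/Num.norm /= mx_normrE; apply/bigmax_leP; split; first exact: enorm_ge0.
case=> i j _ /=; rewrite (ord1 i) -sqrtr_sqr ler_wsqrtr// /dot (bigD1 j)//=.
rewrite -expr2 lerDl; apply: sumr_ge0 => k _; by rewrite -expr2 sqr_ge0.
Qed.

End Dot.

Lemma norm_row_le {R : realType} {n : nat} (u : 'rV[R]_n) (e : R) : 0 <= e ->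
  (forall i, `|u ord0 i| <= e) -> `|u| <= e.
Proof.
move=> e0 h; rewrite /Num.norm /= mx_normrE; apply/bigmax_leP; split => //.
by case=> i j _ /=; rewrite (ord1 i).
Qed.

Section DotMx.
Context {R : realType} {n m : nat}.

Lemma dot_mulmx (u : 'rV[R]_n) (A : 'M[R]_(n, m)) (v : 'rV[R]_m) :
  dot (u *m A) v = dot u (v *m A^T).
Proof. by rewrite !dotE trmx_mul trmxK mulmxA. Qed.

Lemma norm_mulmx_le (u : 'rV[R]_n) (A : 'M[R]_(n, m)) :
  `|u *m A| <= n%:R * (`|u| * `|A|).
Proof.
rewrite {1}/Num.norm /= mx_normrE; apply/bigmax_leP; split.
  by rewrite mulr_ge0// mulr_ge0.
case=> i j _ /=; rewrite (ord1 i) mxE (le_trans (ler_norm_sum _ _ _))//.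
apply: (@le_trans _ _ (\sum_(i < n) `|u| * `|A|)).
  apply: ler_sum => k _; rewrite normrM ler_pM// ?norm_entry_le//.
  rewrite [leRHS]/Num.norm /= mx_normrE.
  by rewrite (le_bigmax _ (fun j : 'I_n * 'I_m => `|A j.1 j.2|) (k, j)).
by rewrite sumr_const card_ord mulr_natl.
Qed.

End DotMx.

Lemma mulmx_bound {R : realType} {n m : nat} (B : 'M[R]_(n, m)) :
  exists2 b : R, 0 < b & forall u : 'rV[R]_n, `|u *m B| <= b * `|u|.
Proof.
exists (n%:R * `|B| + 1); first by rewrite ltr_wpDl// mulr_ge0.
move=> u; apply: (le_trans (norm_mulmx_le _ _)).
by rewrite mulrDl mul1r [`|u| * `|B|]mulrC mulrA lerDl.
Qed.

(** * Limits *)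

Section Limits.
Context {R : realType} {n : nat}.
Context {T : Type} {F : set_system T} {FF : Filter F}.

Lemma cvg_dot (u v : T -> 'rV[R]_n) (a b : 'rV[R]_n) :
  u @ F --> a -> v @ F --> b -> (fun x => dot (u x) (v x)) @ F --> dot a b.
Proof.
move=> ua vb; rewrite /dot.
elim: (index_enum _) => [|i s IH].
  by rewrite big_nil; under eq_fun do rewrite big_nil; exact: cvg_cst.
rewrite big_cons; under eq_fun do rewrite big_cons.
have c (w : T -> 'rV[R]_n) (l : 'rV[R]_n) : w @ F --> l ->
    w x ord0 i @[x --> F] --> l ord0 i.
  by move=> wc; exact: cvg_comp wc (@coord_continuous R 1 n ord0 i l).
by apply: cvgD => //; apply: cvgM; apply: c.
Qed.

Lemma cvg_enorm (u : T -> 'rV[R]_n) (a : 'rV[R]_n) :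
  u @ F --> a -> (fun x => enorm (u x)) @ F --> enorm a.
Proof.
move=> ua; have := @cvg_comp _ _ _ _ Num.sqrt F _ _ (cvg_dot ua ua).
by apply; exact: sqrt_continuous.
Qed.

Lemma cvg_mulmx m (u : T -> 'rV[R]_n) (A : T -> 'M[R]_(n, m))
    (a : 'rV[R]_n) (B : 'M[R]_(n, m)) :
  u @ F --> a -> A @ F --> B -> (fun x => u x *m A x) @ F --> a *m B.
Proof.
move=> ua AB; apply/cvgrPdistC_lt => /= e e0.
pose K : R := n%:R * (`|a| + 1 + `|B|) + 1.
have K0 : 0 < K by rewrite ltr_wpDl// mulr_ge0// !addr_ge0.
have eK : 0 < Num.min (e / K) 1 by rewrite lt_min divr_gt0//=.
near=> x.
have -> : u x *m A x - a *m B = u x *m (A x - B) + (u x - a) *m B.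
  by rewrite mulmxBr mulmxBl addrA subrK.
have hu : `|u x - a| < Num.min (e / K) 1 by near: x; apply: cvgr_distC_lt.
have hA : `|A x - B| < Num.min (e / K) 1 by near: x; apply: cvgr_distC_lt.
move: hu hA; rewrite !lt_min => /andP[hu hu1] /andP[hA _].
apply: (le_lt_trans (ler_normD _ _)).
apply: (le_lt_trans (lerD (norm_mulmx_le _ _) (norm_mulmx_le _ _))).
have nu : `|u x| <= `|a| + 1.
  by rewrite -[u x](subrK a) addrC (le_trans (ler_normD _ _))// lerD2l ltW.
rewrite -mulrDr; apply: (@le_lt_trans _ _ (n%:R * ((`|a| + 1) * (e / K) + (e / K) * `|B|))).
  by rewrite ler_wpM2l// lerD// ler_pM// ltW.
have -> : n%:R * ((`|a| + 1) * (e / K) + e / K * `|B|) = e / K * (K - 1).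
  by rewrite /K; ring.
rewrite mulrBr mulfVK ?gt_eqF// mulr1 ltrBlDr ltrDl divr_gt0//.
Unshelve. all: by end_near. Qed.

End Limits.

(** * Lower and upper limits of extended real functions *)

Lemma ereal_between {R : realType} (x y : \bar R) : (x < y)%E ->
  exists a : R, (x < a%:E < y)%E.
Proof.
case: x y => [x| |] [y| |] //= h.
- exists ((x + y) / 2); rewrite !lte_fin; move: h; rewrite lte_fin => h; lra.
- by exists (x + 1); rewrite lte_fin ltry ltrDl ltr01.
- by exists (y - 1); rewrite lte_fin ltNyr gtrDl oppr_lt0 ltr01.
- by exists 0; rewrite ltNyr ltry.
Qed.

Section LimInf.
Context {R : realType} {T : choiceType} {X : filteredType T}.
Context {F : set_system X} {FF : Filter F}.
Implicit Types (f : X -> \bar R) (l : \bar R).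

Lemma limf_einf_ge f l : (forall a : R, (a%:E < l)%E ->
  \forall x \near F, (a%:E <= f x)%E) -> (l <= limf_einf f F)%E.
Proof.
move=> h; rewrite leNgt; apply/negP => /ereal_between[a /andP[la al]].
have := h a al => Fa; move: la; apply/negP; rewrite -leNgt limf_einfE.
apply: ereal_sup_ge; exists (ereal_inf (f @` [set x | (a%:E <= f x)%E])).
  by exists [set x | (a%:E <= f x)%E].
by apply: le_ereal_inf_tmp => _ [x ? <-].
Qed.

Lemma limf_einf_near f l : (l < limf_einf f F)%E ->
  \forall x \near F, (l < f x)%E.
Proof.
rewrite limf_einfE => /ereal_sup_gt[_ [V FV <-] h].
apply: filterS FV => x Vx; apply: (lt_le_trans h).
by apply: ereal_inf_lbound; exists x.
Qed.

Lemma limf_esup_le f l : (forall a : R, (l < a%:E)%E ->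
  \forall x \near F, (f x <= a%:E)%E) -> (limf_esup f F <= l)%E.
Proof.
move=> h; rewrite -leeN2 -limf_einfN; apply: limf_einf_ge => a al.
have la : (l < (- a)%:E)%E by rewrite EFinN lteNr.
by apply: filterS (h _ la) => x; rewrite EFinN leeNr.
Qed.

Lemma limf_esup_near f l : (limf_esup f F < l)%E ->
  \forall x \near F, (f x < l)%E.
Proof.
rewrite -lteN2 -limf_einfN => /limf_einf_near.
by apply: filterS => x /=; rewrite lteN2.
Qed.

End LimInf.

Section LimInfSeq.
Context {R : realType}.

Lemma limn_einfE (u : nat -> \bar R) : limn_einf u = limf_einf u \oo.
Proof. by []. Qed.

Lemma limn_esupE (u : nat -> \bar R) : limn_esup u = limf_esup u \oo.
Proof. by []. Qed.

Lemma limn_einf_ge_cvg (u : nat -> \bar R) (b : nat -> R) (l : R) :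
  b @ \oo --> l -> (\forall k \near \oo, ((b k)%:E <= u k)%E) ->
  (l%:E <= limn_einf u)%E.
Proof.
move=> bl bu; rewrite limn_einfE; apply: limf_einf_ge => a; rewrite lte_fin => al.
have := bu; apply: filterS2 (cvgr_gt l bl _ al) => k ab bk.
by apply: le_trans bk; rewrite lee_fin ltW.
Qed.

Lemma limn_esup_le_cvgr (u : nat -> \bar R) (b : nat -> R) (l : R) :
  b @ \oo --> l -> (\forall k \near \oo, (u k <= (b k)%:E)%E) ->
  (limn_esup u <= l%:E)%E.
Proof.
move=> bl bu; rewrite limn_esupE; apply: limf_esup_le => a; rewrite lte_fin => al.
have := bu; apply: filterS2 (cvgr_lt l bl _ al) => k ab bk.
by apply: (le_trans bk); rewrite lee_fin ltW.
Qed.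

End LimInfSeq.

(** * Existence of minimisers *)

Section Minimisers.
Context {R : realType} {n : nat}.

Lemma lsc_addr (phi : 'rV[R]_n -> \bar R) (q : 'rV[R]_n -> R) :
  lower_semicontinuous phi -> continuous q ->
  lower_semicontinuous (fun y => (phi y + (q y)%:E)%E).
Proof.
move=> lphi cq x a; rewrite -lteBlDr// => /ereal_between[b /andP[ab bphi]].
have [V xV hV] := lphi x b bphi.
have ab' : a - b < q x.
  by move: ab; rewrite -EFinB lte_fin ltrBlDr -ltrBlDl.
exists (V `&` [set y | a - b < q y]).
  by apply: filterI => //; apply: (cvgr_gt _ (cq x)).
move=> y [/hV by' aby].
have : (a%:E < b%:E + (q y)%:E)%E by rewrite -EFinD lte_fin -ltrBlDl.
by move/lt_trans; apply; rewrite lteD2rE.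
Qed.

(** The sublevel sets of values above the infimum form a filter base on [A].
    If the infimum were not attained, lower semicontinuity would fail at a
    cluster point of this filter. *)
Lemma lsc_compact_min (A : set 'rV[R]_n) (theta : 'rV[R]_n -> \bar R) :
  lower_semicontinuous theta -> compact A -> A !=set0 ->
  exists2 x, A x & forall y, A y -> (theta x <= theta y)%E.
Proof.
move=> lt cA [a0 Aa0].
set I := ereal_inf [set theta y | y in A].
have [hI|hI] := pselect (exists2 x, A x & (theta x <= I)%E).
  have [x Ax hx] := hI; exists x => // y Ay; apply: (le_trans hx).
  by apply: ereal_inf_lbound; exists y.
have gtI x : A x -> (I < theta x)%E.
  by move=> Ax; rewrite ltNge; apply/negP => ?; apply: hI; exists x.
have Ioo : (I < +oo)%E by apply: lt_le_trans (gtI _ Aa0) (leey _).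
pose G : set_system 'rV[R]_n :=
  [set V | exists2 b : R, (I < b%:E)%E & [set y | A y /\ (theta y <= b%:E)%E] `<=` V].
have [b0 /andP[Ib0 _]] := ereal_between Ioo.
have sub b : (I < b%:E)%E -> exists2 y, A y & (theta y < b%:E)%E.
  by move=> /ereal_inf_lt[_ [y Ay <-] h]; exists y.
have GF : ProperFilter G.
  split.
    move=> [b /sub[y Ay yb] /(_ y)]; apply; split => //; exact: ltW.
  split.
  - by exists b0.
  - move=> V W [b bI bV] [c cI cW]; exists (Num.min b c).
      by rewrite /Num.min; case: ifP.
    move=> y [Ay yb]; split.
      by apply: bV; split => //; rewrite (le_trans yb)// lee_fin ge_min lexx.
    by apply: cW; split => //; rewrite (le_trans yb)// lee_fin ge_min lexx orbT.
  - by move=> V W VW [b bI bV]; exists b => // y /bV /VW.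
have GA : G A by exists b0 => // y [].
have [x [Ax clx]] := cA G GF GA.
have [b /andP[Ib bx]] := ereal_between (gtI x Ax).
have [V xV hV] := lt x b bx.
have Gb : G [set y | A y /\ (theta y <= b%:E)%E] by exists b.
have [y [[_ yb] Vy]] := clx _ _ Gb xV.
by have := hV y Vy; rewrite ltNge yb.
Qed.

Lemma closed_ball_compact (a : 'rV[R]_n) (r : R) :
  compact [set x : 'rV[R]_n | `|x - a| <= r].
Proof.
apply: bounded_closed_compact.
  exists (`|a| + r); split; first exact: num_real.
  move=> M hM x /= xr; apply: le_trans _ (ltW hM).
  by rewrite -[x in leLHS](subrK a) addrC (le_trans (ler_normD _ _))// lerD2l.
have -> : [set x : 'rV[R]_n | `|x - a| <= r] =
          (fun x => `|x - a|) @^-1` [set y | y <= r] by [].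
apply: closed_comp; last exact: closed_le.
move=> x _; have c : (fun y => y - a) @ x --> x - a.
  by apply: (@cvgB _ _ _ (nbhs x) _ id (cst a)) => //; exact: cvg_cst.
exact: cvg_norm c.
Qed.

End Minimisers.

(** * Convex sets, affine hulls and relative interiors *)

Section AffineHull.
Context {R : realType} {m : nat}.
Implicit Types (C : set 'rV[R]_m) (x y z : 'rV[R]_m).

Lemma convex_setP C : convex_set C -> forall x y (t : R), 0 <= t <= 1 ->
  C x -> C y -> C (t *: x + (1 - t) *: y).
Proof.
move=> cC x y t /andP[t0 t1] Cx Cy.
have := cC x y (Itv01 t0 t1) (mem_set Cx) (mem_set Cy).
by rewrite inE.
Qed.

(** Only binary convex combinations are given; the weight missing to reach a
    total of [1] rests on [c0]. *)
Lemma convex_sum C c0 (I : eqType) (s : seq I) (e : I -> 'rV[R]_m) (a : I -> R) :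
  convex_set C -> C c0 -> (forall i, C (c0 + e i)) ->
  (forall i, 0 <= a i) -> \sum_(i <- s) a i <= 1 ->
  C (c0 + \sum_(i <- s) a i *: e i).
Proof.
move=> cC Cc Ce; elim: s a => [|i s IH] a a0; first by rewrite !big_nil addr0.
rewrite !big_cons => le1.
have s0 : 0 <= \sum_(j <- s) a j by exact: sumr_ge0.
have [a1|a1] := ltP (a i) 1; last first.
  have ai1 : a i = 1 by lra.
  have : \sum_(j <- s) a j == 0 by apply/eqP; lra.
  rewrite psumr_eq0// => /allP h.
  rewrite ai1 scale1r big_seq big1 ?addr0// => j js.
  by have /= /eqP -> := h j js; rewrite scale0r.
have b0 : 0 < 1 - a i by rewrite subr_gt0.
have bs : 1 - a i != 0 by rewrite gt_eqF.
have /(convex_setP cC) : 0 <= a i <= 1 by rewrite a0 ltW.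
have := IH (fun j => a j / (1 - a i)).
have -> : \sum_(j <- s) a j / (1 - a i) *: e j =
    (1 - a i)^-1 *: \sum_(j <- s) a j *: e j.
  by rewrite scaler_sumr; apply: eq_bigr => j _; rewrite scalerA mulrC.
rewrite -mulr_suml ler_pdivrMr// mul1r lerBrDl => h2 h1.
have := h1 _ _ (Ce i) (h2 (fun j => divr_ge0 (a0 j) (ltW b0)) le1).
by rewrite !scalerDr addrACA -scalerDl scalerA divff// !scale1r subrKC scale1r.
Qed.

Lemma affine_hull_affine C y c (t : R) : affine_hull C y -> C c ->
  affine_hull C (t *: y + (1 - t) *: c).
Proof.
move=> [k [a [x [Cx a1 ->]]]] Cc.
exists k.+1, (fun i => if unlift ord0 i is Some j then t * a j else 1 - t),
  (fun i => if unlift ord0 i is Some j then x j else c); split.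
- by move=> i; case: unliftP.
- rewrite big_ord_recl unlift_none; under eq_bigr do rewrite liftK.
  by rewrite -mulr_sumr a1 mulr1 subrK.
- rewrite big_ord_recl unlift_none addrC; congr (_ + _).
  by rewrite scaler_sumr; apply: eq_bigr => i _; rewrite liftK scalerA.
Qed.

Lemma sub_affine_hull C : C `<=` affine_hull C.
Proof.
move=> c Cc; exists 1%N, (fun=> 1), (fun=> c); split => //.
  by rewrite big_ord1.
by rewrite big_ord1 scale1r.
Qed.

Lemma affine_hull_rows C k (U : 'M[R]_(k, m)) y : C 0 ->
  (forall i, C (row i U)) -> (y <= U)%MS -> affine_hull C y.
Proof.
move=> C0 CU /submxP[b ->].
exists k.+1, (fun i => if unlift ord0 i is Some j then b ord0 j
                       else 1 - \sum_j b ord0 j),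
  (fun i => if unlift ord0 i is Some j then row j U else 0); split.
- by move=> i; case: unliftP.
- rewrite big_ord_recl unlift_none -[RHS](subrK (\sum_j b ord0 j)).
  by congr (_ + _); apply: eq_bigr => i _; rewrite liftK.
- rewrite big_ord_recl unlift_none scaler0 add0r mulmx_sum_row.
  by apply: eq_bigr => i _; rewrite liftK.
Qed.

Lemma affine_hull_sub C k (U : 'M[R]_(m, k)) y :
  (forall x, C x -> x *m U = 0) -> affine_hull C y -> y *m U = 0.
Proof.
move=> CU [j [a [x [Cx _ ->]]]]; rewrite mulmx_suml big1// => i _.
by rewrite -scalemxAl CU// scaler0.
Qed.

(** A maximal linearly independent family of elements of a set spans it. *)
Lemma span_basis C : exists (k : nat) (U : 'M[R]_(k, m)),
  [/\ row_free U, forall i, C (row i U) & forall x, C x -> (x <= U)%MS].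
Proof.
pose P k := `[< exists U : 'M[R]_(k, m), row_free U /\ forall i, C (row i U) >].
have P0 : exists k, P k.
  exists 0%N; apply/asboolP; exists 0; split; first by rewrite /row_free mxrank0.
  by case.
have Pm k : P k -> (k <= m)%N.
  by move=> /asboolP[U [/eqP Uk _]]; rewrite -[leqLHS]Uk rank_leq_col.
case: (ex_maxnP P0 Pm) => k /asboolP[U [Ufree CU]] kmax.
exists k, U; split => // x Cx; apply/negPn/negP => xU.
have /kmax : P (k + 1)%N; last by rewrite addn1 ltnn.
apply/asboolP; exists (col_mx U x); split.
  rewrite /row_free eqn_leq rank_leq_row /= [leqLHS]addn1.
  have -> : \rank (col_mx U x) = \rank (U + x)%MS by rewrite addsmxE.
  by rewrite -[X in (X < _)%N](eqP Ufree) rank_ltmx// ltmxE addsmxSl /= addsmx_sub submx_refl.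
move=> i; case: (splitP i) => j ij.
  have -> : i = lshift 1 j by apply: val_inj.
  by rewrite rowKu; exact: CU.
have -> : i = rshift k j by apply: val_inj.
by rewrite rowKd row_id.
Qed.

(** The barycentre of a maximal affinely independent family of points of [C] is
    a relative interior point: barycentric coordinates are continuous on the
    affine hull, so they stay positive near the barycentre. *)
Lemma relint_nonempty C : convex_set C -> C !=set0 -> relint C !=set0.
Proof.
move=> cC [c0 Cc0].
have [k [U [Ufree CU spanU]]] := span_basis [set x - c0 | x in C].
have CU' i : C (c0 + row i U).
  by have [x Cx <-] := CU i; rewrite addrC subrK.
pose a : R := (k.+1%:R)^-1.
have a0 : 0 < a by rewrite invr_gt0 ltr0n.
have hC (b : 'rV[R]_k) : (forall i, 0 <= b ord0 i) -> \sum_i b ord0 i <= 1 ->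
    C (c0 + b *m U).
  by move=> b0 b1; rewrite mulmx_sum_row; apply: convex_sum.
pose z := c0 + (const_mx a : 'rV[R]_k) *m U.
have sa : \sum_(i < k) a < 1.
  by rewrite sumr_const card_ord -mulr_natl ltr_pdivrMr ?ltr0n// mul1r ltr_nat.
exists z; split.
  apply: hC => [i|]; first by rewrite mxE ltW.
  by under eq_bigr do rewrite mxE; exact: ltW.
pose coef y := (y - c0) *m pinvmx U.
have coefz : coef z = const_mx a by rewrite /coef /z addrC addKr mulmxKp.
have ccoef : coef @ z --> coef z.
  apply: (cvg_mulmx (F := nbhs z) (A := cst (pinvmx U))); last exact: cvg_cst.
  by apply: (@cvgB _ _ _ (nbhs z) _ id (cst c0)) => //; exact: cvg_cst.
have pos : \forall y \near z, forall i, 0 < coef y ord0 i.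
  apply: (@filter_forall _ _ _ (nbhs z)) => i.
  have h : coef y ord0 i @[y --> z] --> coef z ord0 i.
    exact: cvg_comp ccoef (@coord_continuous R 1 k ord0 i (coef z)).
  by apply: (cvgr_gt _ h); rewrite coefz mxE.
have lt1 : \forall y \near z, dot (coef y) (const_mx 1) < 1.
  have h : dot (coef y) (const_mx 1) @[y --> z] --> dot (coef z) (const_mx 1).
    exact: cvg_dot ccoef (cvg_cst (const_mx 1 : 'rV[R]_k)).
  apply: (cvgr_lt _ h); rewrite coefz /dot; under eq_bigr do rewrite !mxE mulr1.
  exact: sa.
apply: filterS2 pos lt1 => y pos lt1 [j [b [x [Cx b1 yE]]]].
have yU : (y - c0 <= U)%MS.
  have -> : y - c0 = \sum_i b i *: (x i - c0).
    under eq_bigr do rewrite scalerBr.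
    by rewrite sumrB -scaler_suml b1 scale1r yE.
  apply: summx_sub => i _; apply: scalemx_sub; apply: spanU.
  by exists (x i).
have -> : y = c0 + coef y *m U by rewrite mulmxKpV// addrC subrK.
apply: hC => [i|]; first exact: ltW.
apply: le_trans (ltW lt1); rewrite le_eqVlt; apply/orP; left; apply/eqP.
by apply: eq_bigr => i _; rewrite [const_mx _ _ _]mxE mulr1.
Qed.

(** The homothety [g] of centre [a] that maps the new point to [b] preserves the
    affine hull of [C]; a point near the new one is a convex combination of [a]
    and of its image near [b]. *)
Lemma relint_segment C a b (s : R) : convex_set C -> C a -> relint C b ->
  0 < s <= 1 -> relint C ((1 - s) *: a + s *: b).
Proof.
move=> cC Ca [Cb bC] /andP[s0 s1].
have s01 : 0 <= s <= 1 by rewrite s1 ltW.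
split; first by rewrite addrC; exact: convex_setP.
pose g y := s^-1 *: y + (1 - s^-1) *: a.
have gE : g ((1 - s) *: a + s *: b) = b.
  rewrite /g scalerDr !scalerA mulVf ?gt_eqF// scale1r addrAC -scalerDl.
  have -> : s^-1 * (1 - s) + (1 - s^-1) = 0 by field; rewrite gt_eqF.
  by rewrite scale0r add0r.
have cg : g @ ((1 - s) *: a + s *: b) --> b.
  rewrite -[X in _ --> X]gE.
  apply: (@cvgD _ _ _ (nbhs _) _ (fun y => s^-1 *: y) (cst _)); last exact: cvg_cst.
  by apply: cvgZr.
have gC : nbhs ((1 - s) *: a + s *: b) (g @^-1` [set y | affine_hull C y -> C y]).
  exact: cg.
apply: filterS gC => y /= h yC.
have -> : y = s *: g y + (1 - s) *: a.
  rewrite /g scalerDr !scalerA divff ?gt_eqF// scale1r -addrA -scalerDl.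
  have -> : s * (1 - s^-1) + (1 - s) = 0 by field; rewrite gt_eqF.
  by rewrite scale0r addr0.
apply: convex_setP => //; apply: h; exact: affine_hull_affine.
Qed.

End AffineHull.

(** * Normal cones, exposed faces and tangent cones *)

(** First-order condition at the boundary point [0], obtained by dividing by
    [e] and letting it tend to [0]. *)
Lemma quad_le0 {R : realType} (a b : R) :
  (forall e, 0 < e < 1 -> 0 <= e * e * b - 2 * e * a) -> a <= 0.
Proof.
move=> h; rewrite leNgt; apply/negP => a0.
pose e := Num.min (2^-1) (a / (`|b| + 1)).
have b1 : 0 < `|b| + 1 by rewrite ltr_wpDl.
have e0 : 0 < e by rewrite lt_min invr_gt0 ltr0n/= divr_gt0.
have e1 : e < 1 by rewrite gt_min invf_lt1 ?ltr0n// ltr1n.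
have eb : e * (`|b| + 1) <= a by rewrite -ler_pdivlMr// ge_min lexx orbT.
have := h e; rewrite e0 e1 => /(_ isT).
have -> : e * e * b - 2 * e * a = e * (e * b - 2 * a) by ring.
rewrite pmulr_rge0// => hh.
have : e * b <= e * `|b| by rewrite ler_pM2l// ler_norm.
lra.
Qed.

Section Cones.
Context {R : realType} {m : nat}.
Variables (Q : set 'rV[R]_m) (l : 'rV[R]_m).
Hypothesis Ql : Q l.
Implicit Types (x y z p v : 'rV[R]_m).
Local Notation N := (normal_cone Q l).
Local Notation G := (smallest_exposed_face Q l).

Lemma normal_cone0 : N 0.
Proof. by split => // y _; rewrite dot0l. Qed.

Lemma normal_coneD x y : N x -> N y -> N (x + y).
Proof.
move=> [_ Nx] [_ Ny]; split => // q Qq.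
by rewrite dotDl -[leRHS](addr0 0) lerD// ?Nx ?Ny.
Qed.

Lemma normal_coneZ (a : R) x : 0 <= a -> N x -> N (a *: x).
Proof.
by move=> a0 [_ Nx]; split => // q Qq; rewrite dotZl mulr_ge0_le0// Nx.
Qed.

Lemma convex_normal_cone : convex_set N.
Proof.
move=> x y t /set_mem Nx /set_mem Ny; apply/mem_set.
change (N (t%:num *: x + (1 - t%:num) *: y)).
by apply: normal_coneD; apply: normal_coneZ; rewrite // subr_ge0.
Qed.

Lemma relint_normal_coneD x y : relint N x -> N y -> relint N (x + y).
Proof.
move=> [Nx xN] Ny; split; first exact: normal_coneD.
have [k [U [_ NU spanU]]] := span_basis N.
have c : (fun z => z - y) @ (x + y) --> x.
  rewrite -[X in _ --> X](addrK y).
  by apply: (@cvgB _ _ _ (nbhs _) _ id (cst y)) => //; exact: cvg_cst.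
have yN : nbhs (x + y) ((fun z => z - y) @^-1` [set z | affine_hull N z -> N z]).
  exact: c.
apply: filterS yN => z /= h zN; rewrite -(subrK y z); apply: normal_coneD => //.
apply: h; apply: (affine_hull_rows normal_cone0 NU).
apply: addmx_sub; last by rewrite -scaleN1r scalemx_sub// spanU.
have := @affine_hull_sub _ _ N _ (cokermx U) z.
move=> /(_ _ zN) h; rewrite submxE h// => w Nw; apply/eqP.
by rewrite -submxE spanU.
Qed.

Lemma relint_normal_cone_near k (U : 'M[R]_(k, m)) x :
  (forall i, N (row i U)) -> relint N x ->
  \forall y \near x, (y <= U)%MS -> relint N y.
Proof.
move=> NU [_ /nbhs_interior xN]; apply: filterS xN => y yN yU; split => //.
exact: (nbhs_singleton yN) (affine_hull_rows normal_cone0 NU yU).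
Qed.

Lemma relint_normal_coneZ (a : R) x : 0 < a -> relint N x -> relint N (a *: x).
Proof.
move=> a0 [Nx xN]; split; first by apply: normal_coneZ => //; exact: ltW.
have [k [U [_ NU spanU]]] := span_basis N.
have c : (fun z => a^-1 *: z) @ (a *: x) --> x.
  by rewrite -[X in _ --> X](scalerK (lt0r_neq0 a0)); exact: scaler_continuous.
have aN : nbhs (a *: x) ((fun z => a^-1 *: z) @^-1` [set z | affine_hull N z -> N z]).
  exact: c.
apply: filterS aN => z /= h zN.
rewrite -[z](scalerKV (lt0r_neq0 a0)); apply: normal_coneZ; first exact: ltW.
apply: h; apply: (affine_hull_rows normal_cone0 NU); apply: scalemx_sub.
rewrite submxE; apply/eqP; apply: affine_hull_sub zN => w Nw; apply/eqP.
by rewrite -submxE spanU.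
Qed.

Lemma support_ge q y : Q q -> ((dot q y)%:E <= support Q y)%E.
Proof. by move=> Qq; apply: ereal_sup_ubound; exists q. Qed.

(** Every nonzero normal [y] exposes a face containing [l], hence every point
    of the smallest exposed face maximises [y] over [Q]. *)
Lemma support_face y q : N y -> G q -> support Q y = (dot q y)%:E.
Proof.
move=> [_ Ny] [Qq Gq].
have ley q' : Q q' -> dot q' y <= dot l y.
  by move=> /Ny; rewrite dotBr subr_le0 !(dotC y).
have suppE : support Q y = (dot l y)%:E.
  apply/eqP; rewrite eq_le support_ge// andbT.
  by apply: ge_ereal_sup => _ [q' Qq' <-]; rewrite lee_fin ley.
have [->|y0] := eqVneq y 0.
  rewrite dot0r; apply/eqP; rewrite eq_le; apply/andP; split.
    by apply: ge_ereal_sup => _ [q' _ <-]; rewrite dot0r.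
  by apply: ereal_sup_ubound; exists l => //; rewrite dot0r.
have [] := Gq [set q' | Q q' /\ (dot y q')%:E = support Q y].
  split; first by exists y.
  by split => //; rewrite suppE dotC.
by move=> _ <-; rewrite dotC.
Qed.

Lemma normal_cone_face y q : N y -> G q -> normal_cone Q q y.
Proof.
move=> Ny Gq; have [Qq _] := Gq; split => // q' Qq'.
rewrite dotBr subr_le0 !(dotC y) -lee_fin -(support_face Ny Gq).
exact: support_ge.
Qed.

Lemma face_self : G l.
Proof. by split => // A [_]. Qed.

Lemma convex_face : convex_set Q -> convex_set G.
Proof.
move=> cQ a b t /set_mem[Qa Ga] /set_mem[Qb Gb]; apply/mem_set; split.
  by have := cQ a b t (mem_set Qa) (mem_set Qb); rewrite inE.
move=> A [[x x0 AE] Al].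
have [Aa Ab] : A a /\ A b.
  by split; [apply: Ga|apply: Gb]; split => //; exists x.
move: Aa Ab; rewrite AE => -[_ xa] [_ xb]; split.
  by have := cQ a b t (mem_set Qa) (mem_set Qb); rewrite inE.
move: xa xb; rewrite -!/(dot _ _) => xa xb.
rewrite -xa; congr EFin; have -> : conv t a b = t%:num *: a + (1 - t%:num) *: b by [].
have ab : dot x a = dot x b by apply: EFin_inj; rewrite xa xb.
by rewrite dotDr !dotZr -ab -mulrDl subrKC mul1r.
Qed.

Lemma lineality_tangent_orth p y :
  lineality (tangent_cone Q l) p -> N y -> dot p y = 0.
Proof.
have aux w : tangent_cone Q l w -> N y -> dot w y <= 0.
  move=> [t [w_ [[t0 _] wcvg wQ]]] [_ Ny].
  have c : (fun k => dot (w_ k) y) @ \oo --> dot w y.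
    by apply: cvg_dot => //; exact: cvg_cst.
  have [//|wy] := leP (dot w y) 0.
  have [k _ /(_ k (leqnn k))] := cvgr_gt _ c _ wy.
  have := Ny _ (wQ k); rewrite addrC addKr dotZr dotC pmulr_rle0//.
  by rewrite leNgt => /negbTE ->.
move=> [pT nT] Ny; apply/eqP; rewrite eq_le aux//=.
by rewrite -oppr_le0 -dotNl aux.
Qed.

(** Bipolar relation: the residual of projecting [p] onto the closed cone
    generated by [Q - l] is a normal vector orthogonal to [p], hence zero. *)
Lemma orth_normal_tangent p : convex_set Q -> (forall v, N v -> dot p v = 0) ->
  tangent_cone Q l p.
Proof.
move=> cQ pN.
(* [K0] is the cone generated by [Q - l] and [K] its closure. *)
pose K0 := [set z | exists s q, [/\ 0 < s, Q q & z = s *: (q - l)]].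
have K00 : K0 0 by exists 1, l; rewrite subrr scaler0.
have K0D x y : K0 x -> K0 y -> K0 (x + y).
  move=> [s [q [s0 Qq ->]]] [s' [q' [s'0 Qq' ->]]].
  have ss : 0 < s + s' by rewrite addr_gt0.
  exists (s + s'), ((s / (s + s')) *: q + (1 - s / (s + s')) *: q'); split => //.
    apply: convex_setP => //; rewrite (divr_ge0 (ltW s0) (ltW ss)) /= ler_pdivrMr//.
    by rewrite mul1r lerDl ltW.
  have -> : 1 - s / (s + s') = s' / (s + s') by field; rewrite gt_eqF.
  by apply/rowP => i; rewrite !mxE; field; rewrite gt_eqF.
have K0Z a x : 0 < a -> K0 x -> K0 (a *: x).
  move=> a0 [s [q [s0 Qq ->]]]; exists (a * s), q; split => //.
    by rewrite mulr_gt0.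
  by rewrite scalerA.
pose K := closure K0.
have KP x : K x <-> forall e, 0 < e -> exists2 y, K0 y & `|x - y| < e.
  split.
    move=> Kx e e0; have [|y [Ky /= xy]] := Kx (ball x e).
      exact: nbhsx_ballx.
    by exists y => //; move: xy; rewrite -ball_normE.
  move=> h B /nbhs_ballP[e /= e0 eB]; have [y Ky xy] := h e e0.
  by exists y; split => //; apply: eB; rewrite -ball_normE.
have KD x y : K x -> K0 y -> K (x + y).
  move=> /KP hx Ky; apply/KP => e /hx[z Kz xz]; exists (z + y); first exact: K0D.
  by rewrite opprD addrACA subrr addr0.
have KZ a x : 0 < a -> K x -> K (a *: x).
  move=> a0 /KP hx; apply/KP => e e0; have [|z Kz xz] := hx (e / a).
    by rewrite divr_gt0.
  exists (a *: z); first exact: K0Z.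
  by rewrite -scalerBr normrZ gtr0_norm// mulrC -ltr_pdivlMr.
pose f y := dot (p - y) (p - y).
have [d Kd dmin] : exists2 d, K d & forall y, K y -> f d <= f y.
  pose A := K `&` [set y | `|y - p| <= enorm p].
  have cA : compact A.
    apply: bounded_closed_compact.
      have [M [Mr hM]] := compact_bounded (@closed_ball_compact R m p (enorm p)).
      by exists M; split => // M' MM' y [_ yp]; apply: (hM M').
    apply: closedI; first exact: closed_closure.
    exact: compact_closed (@closed_ball_compact R m p (enorm p)).
  have A0 : A 0.
    split; first exact: subset_closure.
    by rewrite /= sub0r normrN norm_le_enorm.
  have cf : lower_semicontinuous (fun y => (0 + (f y)%:E)%E : \bar R).
    apply: lsc_addr.
      move=> x a a0; exists setT => // ; exact: filterT.
    move=> y.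
    have c : (fun y => p - y) @ y --> p - y.
      apply: (@cvgB _ _ _ (nbhs y) _ (cst p) id) => //; exact: cvg_cst.
    exact: (cvg_dot c c).
  have [d [Kd _] dmin] := lsc_compact_min cf cA (ex_intro _ 0 A0).
  have dmin' y : A y -> f d <= f y.
    by move=> /dmin; rewrite !add0e lee_fin.
  exists d => // y Ky.
  have [yp|yp] := leP `|y - p| (enorm p); first exact: dmin'.
  apply: (le_trans (dmin' 0 A0)); rewrite /f subr0 -!sqr_enorm.
  rewrite lerXn2r ?nnegrE ?enorm_ge0// (le_trans (ltW yp))// distrC.
  exact: norm_le_enorm.
have [v vE] : exists v, v = p - d by exists (p - d).
have Nv : N v.
  split => // q Qq; apply: (@quad_le0 _ _ (dot (q - l) (q - l))) => e /andP[e0 _].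
  have : f d <= f (d + e *: (q - l)).
    by apply: dmin; apply: KD => //; exists e, q.
  rewrite /f opprD addrA -vE -subr_ge0 => h; apply: (le_trans h).
  move: (q - l) => w.
  rewrite !dotlin (dotC w v) le_eqVlt; apply/orP; left; apply/eqP; ring.
have vd : - dot v d <= 0.
  apply: (@quad_le0 _ _ (dot d d)) => e /andP[e0 e1].
  have : f d <= f ((1 - e) *: d) by apply: dmin; apply: KZ; rewrite ?subr_gt0.
  rewrite /f scalerBl scale1r opprB addrCA -vE -subr_ge0 => h.
  apply: (le_trans h).
  rewrite !dotlin (dotC d v) le_eqVlt; apply/orP; left; apply/eqP; ring.
have : dot v v = 0.
  apply/eqP; rewrite eq_le dot_ge0 andbT {2}vE dotBr (dotC v p) pN// sub0r//.
move=> /eqP; rewrite dot_eq0 vE subr_eq0 => /eqP pd.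
have Kp : K p by rewrite pd.
(* Points of [Q] reached with steps bounded by [1 / k.+1]: shorter steps stay in
   [Q] by convexity. *)
have /choice [g hg] : forall k : nat, exists z : R * 'rV[R]_m,
    [/\ 0 < z.1, Q z.2 & `|p - z.1 *: (z.2 - l)| < k.+1%:R^-1].
  move=> k; have [|y [s [q [s0 Qq ->]]] h] := (KP p).1 Kp (k.+1%:R^-1).
    by rewrite invr_gt0 ltr0n.
  by exists (s, q).
exists (fun k => Num.min ((g k).1^-1) k.+1%:R^-1), (fun k => (g k).1 *: ((g k).2 - l)).
have tpos k : 0 < Num.min ((g k).1^-1) (k.+1%:R^-1 : R).
  by have [g0 _ _] := hg k; rewrite lt_min !invr_gt0 g0 ltr0n.
have h0 : (fun k => k.+1%:R^-1 : R) @ \oo --> (0 : R) by exact: cvg_harmonic.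
split.
- split => //; apply: (squeeze_cvgr _ (cvg_cst 0) h0).
  by near=> k; rewrite (ltW (tpos k)) ge_min lexx orbT.
- apply/cvgrPdist_lt => e e0; near=> k; have [_ _ h] := hg k.
  by apply: (lt_trans h); near: k; apply: (cvgr_lt _ h0).
- move=> k; have [g0 Qg _] := hg k; set t := Num.min _ _.
  have -> : l + t *: ((g k).1 *: ((g k).2 - l)) =
      (t * (g k).1) *: (g k).2 + (1 - t * (g k).1) *: l.
    by rewrite scalerA scalerBr scalerBl scale1r addrCA.
  apply: convex_setP => //; apply/andP; split.
    by rewrite mulr_ge0// ltW// tpos.
  by rewrite -ler_pdivlMr// mul1r ge_min lexx.
Unshelve. all: by end_near. Qed.

Lemma orth_normal_lineality p : convex_set Q ->
  (forall v, N v -> dot p v = 0) -> lineality (tangent_cone Q l) p.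
Proof.
move=> cQ pN; split; apply: orth_normal_tangent => // v Nv.
by rewrite dotNl pN// oppr0.
Qed.

End Cones.

(** * Taylor expansions *)

Section Diff.
Context {R : realType}.

Lemma diff_near (V W : normedModType R) (f : V -> W) (x : V) (e : R) :
  differentiable f x -> 0 < e ->
  \forall h \near (0 : V), `|f (x + h) - f x - 'd f x h| <= e * `|h|.
Proof.
move=> df e0; have /eqaddoP /(_ e e0) := diff_locally df.
apply: (@filterS _ (nbhs 0)) => h /=.
by rewrite /= [x + h]addrC opprD addrA.
Qed.

Context {n : nat}.
Implicit Types (g : 'rV[R]_n -> R) (x y h : 'rV[R]_n).

Lemma diff_grad g x h : differentiable g x -> 'd g x h = dot h (grad g x).
Proof.
move=> dg; rewrite {1}[h]row_sum_delta linear_sum /dot; apply: eq_bigr => i _.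
by rewrite linearZ /= /grad mxE deriveE.
Qed.

Lemma diff_hess g x h : differentiable (grad g) x ->
  'd (grad g) x h = h *m hess g x.
Proof. by move=> dg; rewrite /hess /jacobian mul_rV_lin1. Qed.

Lemma segment_is_derive g x h (s : R) : differentiable g (x + s *: h) ->
  is_derive s 1 (fun t => g (x + t *: h)) (dot h (grad g (x + s *: h))).
Proof.
move=> dg.
have qE : (fun k : R => k^-1 *: (((fun t => g (x + t *: h)) \o shift s) (k *: 1)
              - g (x + s *: h))) =
          (fun k : R => k^-1 *: ((g \o shift (x + s *: h)) (k *: h) - g (x + s *: h))).
  apply/funext => k /=; congr (_ *: (g _ - _)).
  have -> : (k *: (1 : R)) = k by exact: mulr1.
  by rewrite scalerDl addrCA.
have dgh : derivable g (x + s *: h) h by apply: diff_derivable.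
apply: DeriveDef; first by rewrite /derivable qE; exact: dgh.
rewrite /derive qE -[LHS]/('D_h g (x + s *: h)) deriveE//.
exact: diff_grad.
Qed.

(** Mean value theorem for [g] along a segment, corrected by the polynomial
    [s * a + s ^+ 2 * (b / 2)]: taking for [a] and [b] the gradient and Hessian
    terms gives Taylor's formula, and [b = 0] gives strict differentiability. *)
Lemma segment_mvt g x h (a b : R) :
  (forall s : R, 0 <= s <= 1 -> differentiable g (x + s *: h)) ->
  exists2 s : R, 0 <= s <= 1 & g (x + h) - g x - a - b / 2 =
    dot h (grad g (x + s *: h)) - a - s * b.
Proof.
move=> dg; pose G (s : R) := g (x + s *: h) - s * a - s ^+ 2 * (b / 2).
have dG (s : R) : 0 <= s <= 1 ->
    is_derive s 1 G (dot h (grad g (x + s *: h)) - a - s * b).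
  move=> s01; have dgs := segment_is_derive (dg s s01).
  have -> : G = (fun s : R => g (x + s *: h)) - (fun s : R => s * a)
                 - (fun s : R => s ^+ 2 * (b / 2)) by [].
  apply: is_derive_eq.
  have sc1 (c : R) : c *: (1 : R) = c by exact: mulr1.
  by rewrite !scaler0 !add0r !sc1 -[_ *: (_ + _)]/(b / 2 * (s + s)); field.
have dG1 (s : R) : s \in `]0, 1[%R ->
    is_derive s 1 G (dot h (grad g (x + s *: h)) - a - s * b).
  by rewrite in_itv /= => /andP[s0 s1]; apply: dG; rewrite !ltW.
have cG : {within `[0, 1], continuous G}.
  apply: derivable_within_continuous => s; rewrite in_itv /= => s01.
  by have := dG s s01.
have [s s01 E] := MVT_segment ler01 dG1 cG.
exists s; first by move: s01; rewrite in_itv.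
by move: E; rewrite /G scale1r scale0r addr0 subr0 mulr1 => <-; field.
Qed.

Lemma diff_taylor2 g x (e : R) : 0 < e ->
  (\forall y \near x, differentiable g y) -> differentiable (grad g) x ->
  \forall h \near (0 : 'rV[R]_n), `|g (x + h) - g x - dot h (grad g x)
     - dot h (h *m hess g x) / 2| <= e * `|h| ^+ 2.
Proof.
move=> e0 dg dgg.
pose d := e / (n%:R + 1).
have n1 : 0 < (n%:R + 1 : R) by rewrite ltr_wpDl.
have d0 : 0 < d by rewrite divr_gt0.
have /nbhs_ballP[r /= r0 hr] := dg.
have /nbhs_ballP[r' /= r'0 hr'] := diff_near dgg d0.
apply/nbhs_ballP; exists (Num.min r r') => /=; first by rewrite lt_min r0.
move=> h; rewrite -ball_normE /= sub0r normrN lt_min => /andP[hh hh'].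
have small (s : R) : 0 <= s <= 1 -> `|s *: h| <= `|h|.
  by move=> /andP[s0 s1]; rewrite normrZ ger0_norm// ler_piMl.
have dgs (s : R) : 0 <= s <= 1 -> differentiable g (x + s *: h).
  move=> s01; apply: hr; rewrite -ball_normE /= opprD addrA subrr sub0r normrN.
  exact: le_lt_trans (small s s01) hh.
have [s s01 ->] := segment_mvt (dot h (grad g x)) (dot h (h *m hess g x)) dgs.
have : `|grad g (x + s *: h) - grad g x - (s *: h) *m hess g x| <= d * `|s *: h|.
  rewrite -diff_hess//; apply: hr'.
  by rewrite -ball_normE /= sub0r normrN (le_lt_trans (small s s01)).
rewrite -scalemxAl => le.
have -> : dot h (grad g (x + s *: h)) - dot h (grad g x) - s * dot h (h *m hess g x)
  = dot h (grad g (x + s *: h) - grad g x - s *: (h *m hess g x)).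
  by rewrite !dotBr dotZr.
apply: (le_trans (dot_le_norm _ _)).
have nh := normr_ge0 h.
have le2 : `|grad g (x + s *: h) - grad g x - s *: (h *m hess g x)| <= d * `|h|.
  by apply: (le_trans le); rewrite ler_pM2l// small.
apply: (@le_trans _ _ (n%:R * (`|h| * (d * `|h|)))).
  by rewrite ler_wpM2l// ler_wpM2l.
have -> : n%:R * (`|h| * (d * `|h|)) = (n%:R * d) * `|h| ^+ 2 by ring.
rewrite ler_wpM2r// ?sqr_ge0// /d mulrA ler_pdivrMr// mulrC ler_pM2l//.
by rewrite lerDl.
Qed.

Lemma strict_diff g x (e : R) : 0 < e ->
  (\forall y \near x, differentiable g y) -> {for x, continuous (grad g)} ->
  exists2 r : R, 0 < r & forall y z, `|y - x| < r -> `|z - x| < r ->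
    `|g y - g z - dot (y - z) (grad g x)| <= e * `|y - z|.
Proof.
move=> e0 dg cg; pose d := e / (n%:R + 1).
have n1 : 0 < (n%:R + 1 : R) by rewrite ltr_wpDl.
have d0 : 0 < d by rewrite divr_gt0.
have /nbhs_ballP[r /= r0 hr] := dg.
have cg' : grad g @ x --> grad g x by exact: cg.
have /cvgrPdist_le /(_ d d0) /nbhs_ballP[r' /= r'0 hr'] := cg'.
exists (Num.min r r') => /=; first by rewrite lt_min r0.
move=> y z yx zx; set h := y - z.
have near_x (s : R) : 0 <= s <= 1 -> `|z + s *: h - x| < Num.min r r'.
  move=> /andP[s0 s1].
  have -> : z + s *: h - x = s *: (y - x) + (1 - s) *: (z - x).
    by apply/rowP => i; rewrite !mxE; ring.
  rewrite (le_lt_trans (ler_normD _ _))// !normrZ !ger0_norm ?subr_ge0//.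
  have [->|s'] := eqVneq s 0; first by rewrite mul0r subr0 mul1r add0r.
  have sp : 0 < s by rewrite lt_neqAle eq_sym s'.
  have -> : Num.min r r' = s * Num.min r r' + (1 - s) * Num.min r r' by ring.
  by rewrite ltr_leD ?ltr_pM2l// ler_wpM2l ?subr_ge0// ltW.
have dgs (s : R) : 0 <= s <= 1 -> differentiable g (z + s *: h).
  move=> /near_x; rewrite lt_min => /andP[? _]; apply: hr.
  by rewrite -ball_normE /= distrC.
have [s s01] := segment_mvt (dot h (grad g x)) 0 dgs.
rewrite mul0r mulr0 !subr0; have -> : z + h = y by rewrite /h addrC subrK.
move=> ->.
rewrite -dotBr; apply: (le_trans (dot_le_norm _ _)).
have le : `|grad g (z + s *: h) - grad g x| <= d.
  rewrite distrC; apply: hr'; rewrite -ball_normE /= distrC.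
  by have := near_x s s01; rewrite lt_min => /andP[].
apply: (@le_trans _ _ (n%:R * (`|h| * d))).
  by rewrite ler_wpM2l// ler_wpM2l.
have -> : n%:R * (`|h| * d) = (n%:R * d) * `|h| by ring.
rewrite ler_wpM2r// /d mulrA ler_pdivrMr// mulrC ler_pM2l//.
by rewrite lerDl.
Qed.

End Diff.

Section MatrixCvg.
Context {R : realType} {n m : nat} {T : Type} {F : set_system T} {FF : Filter F}.

Lemma cvg_mx_entries (A : T -> 'M[R]_(n, m)) (B : 'M[R]_(n, m)) :
  (forall i j, A x i j @[x --> F] --> B i j) -> A @ F --> B.
Proof.
move=> h; apply/cvgrPdist_le => e e0.
have : \forall x \near F, forall ij : 'I_n * 'I_m, `|B ij.1 ij.2 - A x ij.1 ij.2| <= e.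
  apply: filter_forall => ij.
  by have /cvgrPdist_le /(_ e e0) := h ij.1 ij.2.
apply: filterS => x hx; rewrite {1}/Num.norm /= mx_normrE; apply/bigmax_leP.
by split=> [|ij _]; [exact: ltW|rewrite !mxE].
Qed.

Lemma cvg_entry (A : T -> 'M[R]_(n, m)) (B : 'M[R]_(n, m)) i j :
  A @ F --> B -> A x i j @[x --> F] --> B i j.
Proof. by move=> AB; exact: cvg_comp AB (@coord_continuous R n m i j B). Qed.

Lemma cvg_sum_ord k (f : T -> 'I_k -> R) (l : 'I_k -> R) :
  (forall i, f x i @[x --> F] --> l i) ->
  (fun x => \sum_i f x i) @ F --> \sum_i l i.
Proof.
move=> h; elim: (index_enum _) => [|i s IH].
  by rewrite big_nil; under eq_fun do rewrite big_nil; exact: cvg_cst.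
rewrite big_cons; under eq_fun do rewrite big_cons.
exact: cvgD.
Qed.

End MatrixCvg.

Lemma cvg_trmx {R : realType} {n m : nat} (A : nat -> 'M[R]_(n, m)) (B : 'M[R]_(n, m)) :
  A @ \oo --> B -> (fun j => (A j)^T) @ \oo --> B^T.
Proof.
move=> AB; apply: cvg_mx_entries => a b; rewrite mxE.
have -> : (fun j => (A j)^T a b) = (fun j => A j b a).
  by apply/funext => j; rewrite mxE.
exact: cvg_entry.
Qed.

Lemma cvg_path {R : realType} {n : nat} (t : nat -> R) (w_ : nat -> 'rV[R]_n)
    (x w : 'rV[R]_n) :
  decr0 t -> w_ @ \oo --> w -> (fun j => x + t j *: w_ j) @ \oo --> x.
Proof.
move=> [_ tcvg] ww.
have c : (fun j => t j *: w_ j) @ \oo --> (0 : 'rV[R]_n).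
  by rewrite -(scale0r w); apply: cvgZ.
have h : (fun j => x + t j *: w_ j) @ \oo --> x + 0.
  by apply: cvgD => //; exact: cvg_cst.
by rewrite addr0 in h.
Qed.

Section VectorMap.
Context {R : realType} {n m : nat}.
Variable (F : 'rV[R]_n -> 'rV[R]_m).
Implicit Types (x h w v : 'rV[R]_n).
Local Notation Fi i := (fun y => F y ord0 i).

Lemma differentiable_components x :
  (forall i, differentiable (Fi i) x) -> differentiable F x.
Proof.
move=> dF; have -> : F = \sum_i (fun y => F y ord0 i *: delta_mx ord0 i).
  by apply/funext => y; rewrite fct_sumE; exact: row_sum_delta.
by apply: differentiable_sum => i; apply: differentiableZl.
Qed.

Lemma jacobian_dot x v i : (forall i, differentiable (Fi i) x) ->
  (v *m 'J F x) ord0 i = dot v (grad (Fi i) x).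
Proof.
move=> dF; have dFx := differentiable_components dF.
rewrite -deriveEjacobian// -diff_grad// -deriveE//; apply/esym.
have dv : derivable F x v by exact: diff_derivable.
apply: cvg_lim => //.
have h : (fun k : R => k^-1 *: ((F \o shift x) (k *: v) - F x)) @ 0^' --> 'D_v F x.
  exact: dv.
have h' := cvg_entry (i := ord0) (j := i) h.
under eq_fun => k.
  have -> : k^-1 *: (((fun y => F y ord0 i) \o shift x) (k *: v) - F x ord0 i) =
      (k^-1 *: ((F \o shift x) (k *: v) - F x)) ord0 i by rewrite /= !mxE.
  over.
exact: h'.
Qed.

Lemma cvg_diffquo1 (t : nat -> R) (w_ : nat -> 'rV[R]_n) x w :
  differentiable F x -> decr0 t ->
  w_ @ \oo --> w ->
  (fun k => (t k)^-1 *: (F (x + t k *: w_ k) - F x)) @ \oo --> w *m 'J F x.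
Proof.
move=> dF [t0 tcvg] ww.
have tw : (fun k => t k *: w_ k) @ \oo --> (0 : 'rV[R]_n).
  by rewrite -(scale0r w); apply: cvgZ.
rewrite -[X in _ --> X]addr0.
have -> : (fun k => (t k)^-1 *: (F (x + t k *: w_ k) - F x)) =
  (fun k => w_ k *m 'J F x) +
  (fun k => (t k)^-1 *: (F (x + t k *: w_ k) - F x - (t k *: w_ k) *m 'J F x)).
  apply/funext => k; rewrite !fctE -scalemxAl.
  move: (F _ - F x) (w_ k *m _) => a b.
  by rewrite [in RHS]scalerBr scalerA mulVf ?gt_eqF// scale1r addrC subrK.
apply: cvgD; first exact: (cvg_mulmx ww (cvg_cst _)).
apply/cvgr0Pnorm_le => e e0.
have d0 : 0 < e / (`|w| + 1) by rewrite divr_gt0// ltr_wpDl.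
have := diff_near dF d0 => dn.
have c1 : \forall k \near \oo, `|w_ k| <= `|w| + 1.
  have c : (fun k => `|w_ k|) @ \oo --> `|w| by exact: cvg_norm.
  by apply: (cvgr_le _ c); rewrite ltrDl.
have c2 := tw _ dn; apply: filterS2 c1 c2 => k wk /=.
have -> : (t k *: w_ k) *m 'J F x = 'd F x (t k *: w_ k).
  by rewrite /jacobian mul_rV_lin1.
move=> h; rewrite normrZ gtr0_norm ?invr_gt0// ler_pdivrMl//; apply: (le_trans h).
rewrite normrZ gtr0_norm// mulrCA ler_pM2l//.
by rewrite mulrAC ler_pdivrMr ?ltr_wpDl// ler_pM2l.
Qed.

Section C2.
Variable (U : set 'rV[R]_n).
Hypotheses (Uo : open U) (C2F : forall i, C2_on U (Fi i)).

Lemma C2_diff x : U x -> differentiable F x.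
Proof. by move=> Ux; apply: differentiable_components => i; have [] := C2F i Ux. Qed.

Lemma C2_near_diff x i : U x -> \forall y \near x, differentiable (Fi i) y.
Proof.
move=> Ux; have : nbhs x U by exact: open_nbhs_nbhs.
by apply: filterS => y Uy; have [] := C2F i Uy.
Qed.

Lemma C2_jacobian x v i : U x -> (v *m 'J F x) ord0 i = dot v (grad (Fi i) x).
Proof. by move=> Ux; apply: jacobian_dot => j; have [] := C2F j Ux. Qed.

Lemma C2_jacobian_entry x i j : U x -> 'J F x i j = grad (Fi j) x ord0 i.
Proof.
move=> Ux; have := C2_jacobian (delta_mx ord0 i) j Ux.
rewrite -rowE mxE => ->; rewrite /dot (bigD1 i)//= big1 ?addr0.
  by rewrite mxE !eqxx mul1r.
by move=> k ki; rewrite mxE (negbTE ki) andbF mul0r.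
Qed.

Lemma cvg_jacobian (x_ : nat -> 'rV[R]_n) x : U x -> (forall k, U (x_ k)) ->
  x_ @ \oo --> x -> (fun k => 'J F (x_ k)) @ \oo --> 'J F x.
Proof.
move=> Ux Uk xx; apply: cvg_mx_entries => i j.
have -> : (fun k => 'J F (x_ k) i j) = (fun k => grad (Fi j) (x_ k) ord0 i).
  by apply/funext => k; exact: (C2_jacobian_entry _ _ (Uk k)).
rewrite (C2_jacobian_entry _ _ Ux).
have [_ dg _] := C2F j Ux.
have c : (fun k => grad (Fi j) (x_ k)) @ \oo --> grad (Fi j) x.
  exact: cvg_comp xx (differentiable_continuous dg).
exact: cvg_entry c.
Qed.

Lemma cvg_hessL (x_ : nat -> 'rV[R]_n) (l_ : nat -> 'rV[R]_m) x l : U x ->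
  x_ @ \oo --> x -> l_ @ \oo --> l ->
  (fun k => hessL F (x_ k) (l_ k)) @ \oo --> hessL F x l.
Proof.
move=> Ux xx ll; apply: cvg_mx_entries => i j.
have E y p : hessL F y p i j = \sum_s p ord0 s * hess (Fi s) y i j.
  by rewrite summxE; apply: eq_bigr => s _; rewrite mxE.
have -> : (fun k => hessL F (x_ k) (l_ k) i j) =
    (fun k => \sum_s l_ k ord0 s * hess (Fi s) (x_ k) i j).
  by apply/funext => k; exact: E.
rewrite E; apply: cvg_sum_ord => s.
apply: cvgM; first exact: cvg_entry ll.
have [_ _ ch] := C2F s Ux.
have c : (fun k => hess (Fi s) (x_ k)) @ \oo --> hess (Fi s) x.
  exact: cvg_comp xx ch.
exact: cvg_entry c.
Qed.

Lemma cvg_diffquo2 (t : nat -> R) (w_ : nat -> 'rV[R]_n) x w l : U x -> decr0 t ->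
  w_ @ \oo --> w ->
  (fun k => (t k ^+ 2 / 2)^-1 *
     dot l (F (x + t k *: w_ k) - F x - (t k *: w_ k) *m 'J F x)) @ \oo -->
  dot w (w *m hessL F x l).
Proof.
move=> Ux [t0 tcvg] ww.
have tw : (fun k => t k *: w_ k) @ \oo --> (0 : 'rV[R]_n).
  by rewrite -(scale0r w); apply: cvgZ.
have -> : dot w (w *m hessL F x l) =
    \sum_i l ord0 i * dot w (w *m hess (Fi i) x).
  rewrite /hessL mulmx_sumr dotC dot_suml; apply: eq_bigr => i _.
  by rewrite -scalemxAr dotZl dotC.
under eq_fun do rewrite {1}/dot mulr_sumr.
apply: cvg_sum_ord => i.
have E k : (t k ^+ 2 / 2)^-1 * (l ord0 i *
    (F (x + t k *: w_ k) - F x - (t k *: w_ k) *m 'J F x) ord0 i) =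
  l ord0 i * (dot (w_ k) (w_ k *m hess (Fi i) x) + (t k ^+ 2 / 2)^-1 *
    (Fi i (x + t k *: w_ k) - Fi i x - dot (t k *: w_ k) (grad (Fi i) x)
     - dot (t k *: w_ k) ((t k *: w_ k) *m hess (Fi i) x) / 2)).
  have sub3 (a b c : 'rV[R]_m) :
    (a - b - c) ord0 i = a ord0 i - b ord0 i - c ord0 i by rewrite !mxE.
  rewrite sub3 (C2_jacobian _ _ Ux) -!scalemxAl !dotZr !dotZl.
  by field; rewrite gt_eqF.
under eq_fun do rewrite E.
apply: cvgM; first exact: cvg_cst.
rewrite -[X in _ --> X]addr0; apply: cvgD.
  exact: (cvg_dot ww (cvg_mulmx ww (cvg_cst _))).
apply/cvgr0Pnorm_le => e e0.
have w1 : 0 < (`|w| + 1) ^+ 2 by rewrite exprn_gt0// ltr_wpDl.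
have d0 : 0 < e / 2 / (`|w| + 1) ^+ 2 by rewrite !divr_gt0.
have [_ dg _] := C2F i Ux.
have dn := diff_taylor2 d0 (C2_near_diff i Ux) dg.
have c1 : \forall k \near \oo, `|w_ k| <= `|w| + 1.
  have c : (fun k => `|w_ k|) @ \oo --> `|w| by exact: cvg_norm.
  by apply: (cvgr_le _ c); rewrite ltrDl.
have c2 := tw _ dn; apply: filterS2 c1 c2 => k wk /= h.
have t2 : 0 < t k ^+ 2 / 2 by rewrite divr_gt0// exprn_gt0.
rewrite normrM gtr0_norm ?invr_gt0// ler_pdivrMl//; apply: (le_trans h).
rewrite normrZ gtr0_norm// exprMn.
have : `|w_ k| ^+ 2 <= (`|w| + 1) ^+ 2 by rewrite lerXn2r ?nnegrE// addr_ge0.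
move=> hw; apply: (@le_trans _ _ (e / 2 / (`|w| + 1) ^+ 2 * (t k ^+ 2 * (`|w| + 1) ^+ 2))).
  by rewrite ler_pM2l// ler_pM2l// exprn_gt0.
by rewrite le_eqVlt; apply/orP; left; apply/eqP; field; rewrite gt_eqF// ltr_wpDl.
Qed.

End C2.
End VectorMap.

(** * Second subderivatives as epigraphical limits *)

Section EpiLimit.
Context {R : realType} {n : nat}.
Implicit Types (phi g : 'rV[R]_n -> \bar R) (x v w : 'rV[R]_n).

Lemma decr0_harmonic : decr0 (fun k => k.+1%:R^-1 : R).
Proof. by split; [move=> k; rewrite invr_gt0 ltr0n|exact: cvg_harmonic]. Qed.

Lemma cvg_harmonic_dist (w_ : nat -> 'rV[R]_n) w :
  (forall k, `|w_ k - w| < k.+1%:R^-1) -> w_ @ \oo --> w.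
Proof.
move=> h; apply/cvgrPdistC_lt => e e0; near=> k.
by apply: (lt_trans (h k)); near: k; apply: (cvgr_lt _ cvg_harmonic).
Unshelve. all: by end_near. Qed.

(** A recovery sequence gives one inequality.  Conversely, if the quotients were
    below [a < g h] arbitrarily close to [(0, h)], they would be so along a
    sequence, against the inferior limit inequality. *)
Lemma subderiv2_epi phi x v g :
  (forall t : nat -> R, decr0 t -> epi_cvg (fun k => diffquo2 phi x v (t k)) g) ->
  subderiv2 phi x v = g.
Proof.
move=> hg; apply/funext => h; apply/eqP; rewrite eq_le; apply/andP; split.
  rewrite leNgt; apply/negP => /ereal_between[a /andP[ga al]].
  have [_ [w_ ww hw]] := hg _ decr0_harmonic h.
  have lt_a : \forall k \near \oo, (diffquo2 phi x v k.+1%:R^-1 (w_ k) < a%:E)%E.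
    exact: limf_esup_near (le_lt_trans hw ga).
  have [[A B] [/= A0 Bh] AB] := limf_einf_near al.
  have Ak : \forall k \near \oo, A (k.+1%:R^-1 : R).
    have Ah : \forall k \near \oo, 0 < (k.+1%:R^-1 : R) -> A k.+1%:R^-1.
      exact: (cvg_harmonic A0).
    by apply: filterS Ah => k; apply; rewrite invr_gt0 ltr0n.
  have Bk := ww _ Bh.
  have [k _ /(_ k (leqnn k))[Hk [Ak' Bk']]] := filterI lt_a (filterI Ak Bk).
  by have := AB (_, _) (conj Ak' Bk'); rewrite /= ltNge (ltW Hk).
apply: limf_einf_ge => a ag.
have : ~ (forall k : nat, exists z : R * 'rV[R]_n,
   [/\ 0 < z.1 < k.+1%:R^-1, `|z.2 - h| < k.+1%:R^-1 &
       (diffquo2 phi x v z.1 z.2 < a%:E)%E]).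
  move=> /choice[z hz].
  have td : decr0 (fun k => (z k).1).
    split; first by move=> k; have [/andP[]] := hz k.
    apply: (squeeze_cvgr _ (cvg_cst 0) (@cvg_harmonic R)).
    by near=> k; have [/andP[z0 z1] _ _] := hz k; rewrite !ltW.
  have [/(_ (fun k => (z k).2)) + _] := hg _ td h.
  move=> /(_ _) gl.
  have wh : (fun k => (z k).2) @ \oo --> h.
    by apply: cvg_harmonic_dist => k; have [] := hz k.
  have : \forall k \near \oo, (a%:E < diffquo2 phi x v (z k).1 (z k).2)%E.
    exact: limf_einf_near (lt_le_trans ag (gl wh)).
  move=> [k _ /(_ k (leqnn k))].
  by have [_ _ /ltW] := hz k; rewrite leNgt => /negP.
move=> /existsNP[k hk].
pose e : R := k.+1%:R^-1; have e0 : 0 < e by rewrite invr_gt0 ltr0n.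
exists ([set t | 0 < t < e], [set w | `|w - h| < e]).
  split => /=.
    have := nbhs_right_lt e0.
    apply: filterS2 (nbhs_right_gt 0) => t t0 te /=.
    by rewrite t0.
  by apply/nbhs_ballP; exists e => //= w; rewrite -ball_normE /= distrC.
move=> [t w] [/= t0 wh]; rewrite leNgt; apply/negP => ta.
by apply: hk; exists (t, w).
Unshelve. all: by end_near. Qed.

End EpiLimit.

(** * Differentiable proximity operators *)

Lemma sum_two_index {R : realType} (m : nat) :
  \sum_(i < m) 2 * (i%:R : R) = m%:R * (m%:R - 1).
Proof.
elim: m => [|m IH]; first by rewrite big_ord0 mul0r.
by rewrite big_ord_recr /= IH -natr1; ring.
Qed.

Section ProxDifferentiable.
Context {R : realType} {n : nat}.
Variables (phi : 'rV[R]_n -> \bar R) (P : 'rV[R]_n -> 'rV[R]_n).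
Variables (tau : R) (x v : 'rV[R]_n).
Hypothesis tau0 : 0 < tau.
Hypothesis phi_gtNy : forall y, phi y != -oo%E.
Hypothesis phix : phi x \is a fin_num.
Hypothesis Pmin : forall z,
  argmin (fun y => (phi y + ((2 * tau)^-1 * enorm (z - y) ^+ 2)%:E)%E) (P z).
Local Notation z0 := (x + tau *: v).
Hypothesis Px : P z0 = x.
Hypothesis dP : differentiable P z0.
Local Notation M := ('J P z0).
Implicit Types (t : R) (u w : 'rV[R]_n).

Let phiP z : R := fine (phi (P z)).

Let phiPE z : phi (P z) = (phiP z)%:E.
Proof.
rewrite /phiP fineK// fin_numE phi_gtNy /=.
apply/negP => /eqP pz; have := Pmin z x; rewrite pz addye//.
by rewrite -(fineK phix) -EFinD leye_eq.
Qed.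

(** [wt t u] is the proximal point at [u] of the difference quotient of [phi],
    [dt t u] the value of the quotient there and [E t u] its Moreau envelope (up
    to a factor [2]). *)
Let wt t u := t^-1 *: (P (z0 + t *: u) - x).
Let dt t u := (t ^+ 2 / 2)^-1 *
  (phiP (z0 + t *: u) - fine (phi x) - t * dot v (wt t u)).
Let E t u := dt t u + tau^-1 * dot (wt t u - u) (wt t u - u).
(** [J t] is convex, as a supremum of affine functions, with subgradient
    [2 *: wt t u] at [u]. *)
Let J t u := dot u u - tau * E t u.

Let wtE t u : 0 < t -> x + t *: wt t u = P (z0 + t *: u).
Proof. by move=> t0; rewrite scalerA divff ?gt_eqF// scale1r addrC subrK. Qed.

Let diffquo_wt t u : 0 < t -> diffquo2 phi x v t (wt t u) = (dt t u)%:E.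
Proof. by move=> t0; rewrite /diffquo2 wtE// phiPE -(fineK phix) -!EFinB -EFinM. Qed.

(** The minimality of [P (z0 + t *: u)], rescaled by [t] and recentred at [x]. *)
Let envelope_le t u w : 0 < t -> ((E t u)%:E <=
  diffquo2 phi x v t w + (tau^-1 * dot (w - u) (w - u))%:E)%E.
Proof.
move=> t0; have t2 : 0 < t ^+ 2 / 2 by rewrite divr_gt0// exprn_gt0.
have := Pmin (z0 + t *: u) (x + t *: w); rewrite phiPE /diffquo2 -(fineK phix).
have := phi_gtNy (x + t *: w); case: (phi (x + t *: w)) => [r _| |//]; last first.
  move=> _ _; rewrite (_ : (+oo - _ - _ = +oo)%E)// gt0_muley ?addye ?leey//.
  by rewrite lte_fin invr_gt0.
rewrite -!EFinB -EFinM -!EFinD !lee_fin !sqr_enorm -(wtE u t0) => h.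
rewrite /E /dt.
have e1 y : z0 + t *: u - (x + t *: y) = tau *: v + t *: (u - y).
  by rewrite opprD addrACA [x + _]addrC addrK scalerBr addrA.
have e2 y : (2 * tau)^-1 * dot (z0 + t *: u - (x + t *: y)) (z0 + t *: u - (x + t *: y)) =
    tau / 2 * dot v v + t * dot v u - t * dot v y + t ^+ 2 / 2 * (tau^-1 * dot (y - u) (y - u)).
  have -> : dot (y - u) (y - u) = dot (u - y) (u - y).
    by rewrite -opprB dotNl dotNr opprK.
  rewrite e1 !dotlin (dotC u v) (dotC y v) (dotC y u).
  by field; rewrite gt_eqF.
move: h; rewrite !e2 => h.
have E' (a b : R) : (t ^+ 2 / 2)^-1 * a + b = (t ^+ 2 / 2)^-1 * (a + t ^+ 2 / 2 * b).
  by field; rewrite gt_eqF.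
rewrite !E' ler_pM2l ?invr_gt0//; lra.
Qed.

Let subgrad t u' u : 0 < t -> J t u' + 2 * dot (wt t u') (u - u') <= J t u.
Proof.
move=> t0; have := @envelope_le t u (wt t u') t0.
rewrite diffquo_wt// -EFinD lee_fin => h.
have h' : tau * E t u <= tau * dt t u' + dot (wt t u' - u) (wt t u' - u).
  have := h; rewrite -(ler_pM2l tau0) => h2; apply: (le_trans h2).
  by rewrite [leLHS]mulrDr mulVKf ?gt_eqF.
have e : tau * E t u' = tau * dt t u' + dot (wt t u' - u') (wt t u' - u').
  by rewrite /E mulrDr mulVKf ?gt_eqF.
rewrite /J e; move: h'; move: (wt t u') => a.
rewrite !dotlin (dotC u a) (dotC u' a) => h'; lra.
Qed.

Let J0 t : 0 < t -> J t 0 = 0.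
Proof.
move=> t0; have w0 : wt t 0 = 0 by rewrite /wt scaler0 addr0 Px subrr scaler0.
have d0 : dt t 0 = 0.
  by rewrite /dt w0 dot0r scaler0 addr0 /phiP Px mulr0 subr0 subrr mulr0.
by rewrite /J /E w0 d0 subr0 dot0l mulr0 addr0 mulr0 subr0.
Qed.

Let wt_cvg (t : nat -> R) u : decr0 t ->
  (fun k => wt (t k) u) @ \oo --> u *m M.
Proof.
move=> td; have := @cvg_diffquo1 R n n P t (fun=> u) z0 u dP td (cvg_cst u).
by rewrite Px; apply.
Qed.

(** Along the segment from [0] to [u], cut into [m] pieces, the increments of
    [J t] lie between subgradients at the end points of the pieces.  These
    converge to a linear map, so the lower and upper Riemann sums have limits
    within [`|a| / m] of the claimed one. *)
Let J_cvg (t : nat -> R) u : decr0 t ->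
  (fun k => J (t k) u) @ \oo --> dot (u *m M) u.
Proof.
move=> td; have [t0 _] := td; set a := dot (u *m M) u.
apply/cvgrPdist_le => e e0.
have [m' hm'] : exists m' : nat, 2 * `|a| / e < m'%:R.
  exists (Num.truncn (2 * `|a| / e)).+1.
  by apply: truncnS_gt.
pose m := m'.+1; have m0 : 0 < (m%:R : R) by rewrite ltr0n.
have ham : `|a| / m%:R <= e / 2.
  rewrite ler_pdivrMr// mulrC -ler_pdivrMr; last by rewrite divr_gt0.
  apply: ltW; rewrite invf_div mulrA [_ * 2]mulrC.
  by apply: (lt_le_trans hm'); rewrite ler_nat.
pose p (i : nat) : 'rV[R]_n := (i%:R / m%:R) *: u.
have psub i : p i.+1 - p i = m%:R^-1 *: u.
  by rewrite /p -scalerBl -mulrBl -natr1 addrAC subrr add0r mul1r.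
have tele k : J (t k) u = \sum_(i < m) (J (t k) (p i.+1) - J (t k) (p i)).
  have := telescope_sumr (fun i => J (t k) (p i)) (leq0n m).
  rewrite big_mkord => ->.
  by rewrite /p mul0r scale0r J0// subr0 divff ?gt_eqF// scale1r.
have lo k : \sum_(i < m) 2 * dot (wt (t k) (p i)) (m%:R^-1 *: u) <= J (t k) u.
  rewrite tele; apply: ler_sum => i _.
  have := @subgrad (t k) (p i) (p i.+1) (t0 k); rewrite psub; lra.
have up k : J (t k) u <= \sum_(i < m) 2 * dot (wt (t k) (p i.+1)) (m%:R^-1 *: u).
  rewrite tele; apply: ler_sum => i _.
  have := @subgrad (t k) (p i.+1) (p i) (t0 k).
  rewrite -opprB psub dotNr; lra.
have c (f : nat -> nat) : (fun k => \sum_(i < m) 2 * dot (wt (t k) (p (f i))) (m%:R^-1 *: u))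
    @ \oo --> \sum_(i < m) 2 * ((f i)%:R / m%:R * (m%:R^-1 * a)).
  apply: cvg_sum_ord => i; apply: cvgM; first exact: cvg_cst.
  have -> : (f i)%:R / m%:R * (m%:R^-1 * a) = dot (p (f i) *m M) (m%:R^-1 *: u).
    by rewrite /p -scalemxAl dotZl dotZr.
  have h := @wt_cvg _ (p (f i)) td.
  exact: (@cvg_dot R n nat \oo _ _ (fun=> m%:R^-1 *: u) _ _ h (cvg_cst _)).
have clo := c id; have cup := c S.
have lim_lo : \sum_(i < m) 2 * (i%:R / m%:R * (m%:R^-1 * a)) = a - a / m%:R.
  transitivity ((\sum_(i < m) 2 * (i%:R : R)) * (a / m%:R ^+ 2)).
    rewrite mulr_suml; apply: eq_bigr => i _; by field; rewrite gt_eqF.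
  by rewrite sum_two_index; field; rewrite gt_eqF.
have lim_up : \sum_(i < m) 2 * (i.+1%:R / m%:R * (m%:R^-1 * a)) = a + a / m%:R.
  transitivity ((\sum_(i < m) (2 * (i%:R : R) + 2)) * (a / m%:R ^+ 2)).
    rewrite mulr_suml; apply: eq_bigr => i _; rewrite -natr1; by field; rewrite gt_eqF.
  rewrite big_split /= sum_two_index sumr_const card_ord -mulr_natr.
  by field; rewrite gt_eqF.
rewrite /= lim_lo in clo; rewrite /= lim_up in cup.
have am : `|a / m%:R| <= e / 2 by rewrite normrM normfV (gtr0_norm m0).
move: am; rewrite ler_norml => /andP[am1 am2].
near=> k.
have h1 : a - a / m%:R - e / 2 < \sum_(i < m) 2 * dot (wt (t k) (p i)) (m%:R^-1 *: u).
  near: k; apply: (cvgr_gt _ clo); rewrite gtrBl; lra.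
have h2 : \sum_(i < m) 2 * dot (wt (t k) (p i.+1)) (m%:R^-1 *: u) < a + a / m%:R + e / 2.
  near: k; apply: (cvgr_lt _ cup); rewrite ltrDl; lra.
rewrite ler_norml; have := lo k; have := up k; lra.
Unshelve. all: by end_near. Qed.

Let limit_subgrad u u' :
  dot (u' *m M) u' + 2 * dot (u' *m M) (u - u') <= dot (u *m M) u.
Proof.
pose t := (fun k => k.+1%:R^-1) : nat -> R; have hd : decr0 t := decr0_harmonic.
have c1 := @J_cvg _ u hd; have c2 := @J_cvg _ u' hd.
have h3 := @wt_cvg _ u' hd.
have c4 : (fun k => J (t k) u' + 2 * dot (wt (t k) u') (u - u')) @ \oo -->
    dot (u' *m M) u' + 2 * dot (u' *m M) (u - u').
  apply: cvgD; first exact: c2.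
  apply: cvgM; first exact: cvg_cst.
  exact: (@cvg_dot R n nat \oo _ _ (fun=> u - u') _ _ h3 (cvg_cst _)).
apply: (ler_cvg_to c4 c1); near=> k.
by apply: subgrad; have [h _] := hd; exact: h.
Unshelve. all: by end_near. Qed.

(** Expanding the limit subgradient inequality between [u] and [u + e *: h] to
    first order in [e]. *)
Let symM_le u h : dot (u *m M) h <= dot (h *m M) u.
Proof.
rewrite -subr_le0 -(pmulr_rle0 _ (_ : 0 < 2^-1)) ?invr_gt0//.
apply: (@quad_le0 _ _ (dot (h *m M) h)) => e /andP[e0 _].
have := limit_subgrad (u + e *: h) u.
have -> : u + e *: h - u = e *: h by rewrite addrC addKr.
rewrite mulmxDl -scalemxAl !dotlin => H.
rewrite -subr_ge0 in H; apply: (le_trans H); rewrite le_eqVlt; apply/orP; left.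
by apply/eqP; field.
Qed.

Let symM : M^T = M.
Proof.
have h u w : dot u (w *m M) = dot u (w *m M^T).
  rewrite -dot_mulmx dotC; apply/eqP; rewrite eq_le symM_le.
  by rewrite symM_le.
apply/row_matrixP => i; rewrite !rowE; apply/eqP; rewrite -subr_eq0; apply/eqP.
by apply: dot_eq0_all => u; rewrite dotC dotBr h subrr.
Qed.

(** The envelope bounds the quotients from below at every [u], and its limit is
    the quadratic form of [1 - M].  Taking the supremum over [u] yields the
    conjugate form, finite exactly on the range of [M]; there the proximal
    points [wt t u] are a recovery sequence.  [A] is built from a symmetrised
    generalised inverse of [M]. *)
Lemma prox_differentiable_epi : exists (A : 'M[R]_n) (L : {vspace 'rV[R]_n}),
  A^T = A /\ forall t : nat -> R, decr0 t ->
    epi_cvg (fun k => diffquo2 phi x v (t k))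
            (fun w => ((dot w (w *m A))%:E + ind [set` L] w)%E).
Proof.
have [B MBM] : exists B, forall u, u *m M *m B *m M = u *m M.
  by exists (pinvmx M) => u; rewrite mulmxKpV// submxMl.
pose L := limg (linfun (mulmxr M : 'rV[R]_n -> 'rV[R]_n)).
have LP w : w \in L <-> exists u, w = u *m M.
  split=> [/memv_imgP[u _ ->]|[u ->]]; first by exists u; rewrite lfunE.
  by apply/memv_imgP; exists u; rewrite ?memvf// lfunE.
exists (tau^-1 *: (2^-1 *: (B + B^T) - 1%:M)), L; split.
  by apply/matrixP => i j; rewrite !mxE eq_sym [B j i + _]addrC.
have gE u : dot (u *m M) (u *m M *m (tau^-1 *: (2^-1 *: (B + B^T) - 1%:M))) =
    tau^-1 * (dot (u *m M) u - dot (u *m M) (u *m M)).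
  have e1 : dot (u *m M) (u *m M *m B) = dot (u *m M) u.
    by rewrite dot_mulmx symM MBM dotC.
  have e2 : dot (u *m M) (u *m M *m B^T) = dot (u *m M) u.
    by rewrite -dot_mulmx dotC e1.
  rewrite -scalemxAr dotZr mulmxBr mulmx1 dotBr -scalemxAr dotZr mulmxDr dotDr e1 e2.
  by congr (_ * _); field.
move=> t td w; have [t0 _] := td; split.
- move=> w_ ww.
  have lb u : ((tau^-1 * (2 * dot w u - dot (u *m M) u - dot w w))%:E <=
      limn_einf (fun k => diffquo2 phi x v (t k) (w_ k)))%E.
    have cE : (fun k => E (t k) u) @ \oo --> tau^-1 * (dot u u - dot (u *m M) u).
      have -> : (fun k => E (t k) u) = (fun k => tau^-1 * (dot u u - J (t k) u)).
        apply/funext => k; rewrite /J opprB addrC subrK mulrA mulVf ?mul1r//.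
        by rewrite gt_eqF.
      apply: cvgM; first exact: cvg_cst.
      by apply: cvgB; [exact: cvg_cst|exact: J_cvg].
    have cw : (fun k => tau^-1 * dot (w_ k - u) (w_ k - u)) @ \oo -->
        tau^-1 * dot (w - u) (w - u).
      apply: cvgM; first exact: cvg_cst.
      have c : (fun k => w_ k - u) @ \oo --> w - u by apply: cvgB => //; exact: cvg_cst.
      exact: (cvg_dot c c).
    have -> : tau^-1 * (2 * dot w u - dot (u *m M) u - dot w w) =
        tau^-1 * (dot u u - dot (u *m M) u) - tau^-1 * dot (w - u) (w - u).
      rewrite !dotlin (dotC u w); by ring.
    apply: (limn_einf_ge_cvg (cvgB cE cw)); near=> k; rewrite !fctE.
    by rewrite EFinB leeBlDr//; exact: envelope_le.
  have [wL|wL] := pselect (w \in L).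
    have [u wE] := (LP w).1 wL.
    rewrite /ind asboolT// adde0 wE gE -wE.
    have -> : dot w u - dot w w = 2 * dot w u - dot (u *m M) u - dot w w.
      by rewrite -wE; ring.
    exact: lb.
  (* [w] is outside the range of the symmetric matrix [M]: a kernel vector
     not orthogonal to [w] makes the lower bounds arbitrarily large. *)
  have [u [uM wu]] : exists u, u *m M = 0 /\ dot w u != 0.
    have [K [MK KP]] : exists K : 'M[R]_n,
        M *m K = 0 /\ forall y : 'rV[R]_n, y *m K = 0 -> (y <= M)%MS.
      exists (cokermx M); split; first exact: mulmx_coker.
      by move=> y; rewrite submxE => ->.
    have : w *m K <> 0.
      by move=> /KP/submxP[u wE]; apply: wL; apply/LP; exists u.
    move=> /rowP/existsNP[j hj]; exists (row j K^T); split.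
      by rewrite -row_mul -[X in _ *m X]symM -trmx_mul MK trmx0 row0.
    apply/eqP => h; apply: hj; rewrite [RHS]mxE -h [LHS]mxE.
    by apply: eq_bigr => i _; rewrite !mxE.
  have -> : ((dot w (w *m (tau^-1 *: (2^-1 *: (B + B^T) - 1%:M))))%:E
      + ind [set` L] w)%E = +oo%E by rewrite /ind asboolF.
  rewrite leye_eq; apply/eqP/eqyP => A A0.
  pose s := (tau * A + dot w w) / (2 * dot w u).
  have := lb (s *: u); rewrite -scalemxAl uM scaler0 dot0l subr0 dotZr.
  have -> : tau^-1 * (2 * (s * dot w u) - dot w w) = A.
    by rewrite /s; field; rewrite wu gt_eqF.
  by [].
- have [wL|wL] := pselect (w \in L); last first.
    by exists (fun=> w); [exact: cvg_cst|rewrite /ind asboolF// leey].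
  have [u wE] := (LP w).1 wL.
  exists (fun k => wt (t k) u); first by rewrite wE; exact: wt_cvg.
  rewrite /ind asboolT// adde0 wE gE.
  have cd : (fun k => dt (t k) u) @ \oo -->
     tau^-1 * (dot (u *m M) u - dot (u *m M) (u *m M)).
    have -> : (fun k => dt (t k) u) = (fun k => tau^-1 * (dot u u - J (t k) u
         - dot (wt (t k) u - u) (wt (t k) u - u))).
      by apply/funext => k; rewrite /J /E; field; rewrite gt_eqF.
    have -> : dot (u *m M) u - dot (u *m M) (u *m M) = dot u u - dot (u *m M) u
         - dot (u *m M - u) (u *m M - u).
      rewrite !dotlin (dotC u (u *m M)); by ring.
    apply: cvgM; first exact: cvg_cst.
    have c : (fun k => wt (t k) u - u) @ \oo --> u *m M - u.
      by apply: cvgB; [exact: wt_cvg|exact: cvg_cst].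
    apply: cvgB; last exact: (cvg_dot c c).
    by apply: cvgB; [exact: cvg_cst|exact: J_cvg].
  apply: (limn_esup_le_cvgr cd); near=> k.
  by rewrite diffquo_wt.
Unshelve. all: by end_near. Qed.

End ProxDifferentiable.

(** * Proximal points of prox-regular functions *)

Section ProxRegular.
Context {R : realType} {n : nat}.
Variables (phi : 'rV[R]_n -> \bar R) (tau rho : R) (x v : 'rV[R]_n).
Hypothesis tau0 : 0 < tau.
Hypothesis taurho : tau * rho < 1.
Hypothesis phix : phi x \is a fin_num.
Hypothesis phi_lsc : lower_semicontinuous phi.
Hypothesis phi_minorant : forall y,
  (phi x + (dot v (y - x) - rho / 2 * enorm (y - x) ^+ 2)%:E <= phi y)%E.
Local Notation theta z :=
  (fun y => (phi y + ((2 * tau)^-1 * enorm (z - y) ^+ 2)%:E)%E).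
Local Notation kappa := (tau^-1 - rho).

Let kappa0 : 0 < kappa.
Proof. by rewrite subr_gt0 -[tau^-1]mul1r ltr_pdivlMr// mulrC. Qed.

(** Since [tau * rho < 1] the quadratic term of the proximal objective
    dominates the concave quadratic minorant of [phi]. *)
Lemma prox_objective_ge z y :
  (theta z x + (kappa / 2 * dot (y - x) (y - x)
     - dot (tau^-1 *: (z - x) - v) (y - x))%:E <= theta z y)%E.
Proof.
have := phi_minorant y; rewrite -(fineK phix).
case: (phi y) => [r| |]; last 2 first.
- by move=> _; rewrite addye// leey.
- by rewrite -EFinD leeNy_eq.
rewrite -!EFinD !lee_fin !sqr_enorm => h.
have -> : z - y = (z - x) - (y - x) by rewrite opprB addrA subrK.
move: h; move: (y - x) (z - x) => d a.
rewrite !dotlin (dotC d a) => h.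
have -> : (2 * tau)^-1 * (dot a a - dot a d - (dot a d - dot d d)) =
   (2 * tau)^-1 * dot a a - tau^-1 * dot a d + tau^-1 / 2 * dot d d.
  by field; rewrite gt_eqF.
lra.
Qed.

Lemma prox_argmin z : argmin (theta z) (prox tau phi z).
Proof.
apply: (@getPex _ (argmin (theta z))).
pose b := tau^-1 *: (z - x) - v; pose r := 2 * enorm b / kappa.
have th_lsc : lower_semicontinuous (theta z).
  apply: lsc_addr => // y.
  have c : (fun y => z - y) @ y --> z - y.
    by apply: (@cvgB _ _ _ (nbhs y) _ (cst z) id) => //; exact: cvg_cst.
  have -> : (fun y => (2 * tau)^-1 * enorm (z - y) ^+ 2) =
      (cst (2 * tau)^-1 \* (fun y => dot (z - y) (z - y))).
    by apply/funext => w /=; rewrite sqr_enorm.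
  exact: (@cvgM _ _ (nbhs y) _ _ _ _ _ (cvg_cst _) (cvg_dot c c)).
have r0 : 0 <= r by rewrite divr_ge0 ?mulr_ge0 ?enorm_ge0// ltW.
have [|y Ay hy] := lsc_compact_min th_lsc (@closed_ball_compact R n x r).
  by exists x; rewrite /= subrr normr0.
exists y => w; have [wx|wx] := leP `|w - x| r; first exact: hy.
apply: (le_trans (hy x _)); first by rewrite /= subrr normr0.
apply: le_trans (prox_objective_ge z w); rewrite leeDl// lee_fin subr_ge0 -/b.
apply: (le_trans (dot_le _ _)); rewrite -sqr_enorm expr2 mulrA ler_wpM2r ?enorm_ge0//.
have : r <= enorm (w - x) by rewrite (le_trans (ltW wx))// norm_le_enorm.
rewrite /r ler_pdivrMr// => h; rewrite mulrAC ler_pdivlMr//; lra.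
Qed.

Lemma prox_fixed : prox tau phi (x + tau *: v) = x.
Proof.
set y := prox _ _ _.
have xv : tau^-1 *: (x + tau *: v - x) - v = 0.
  have -> : x + tau *: v - x = tau *: v by rewrite addrC addKr.
  by rewrite scalerA mulVf ?gt_eqF// scale1r subrr.
have := prox_objective_ge (x + tau *: v) y; rewrite xv dot0l subr0.
move=> /le_trans /(_ (prox_argmin (x + tau *: v) x)).
rewrite -(fineK phix) -!EFinD lee_fin gerDl pmulr_rle0; last by rewrite divr_gt0.
move=> h; have : dot (y - x) (y - x) == 0 by rewrite eq_le h dot_ge0.
by rewrite dot_eq0 subr_eq0 => /eqP.
Qed.

End ProxRegular.

(** * Metric regularity *)

Section MetricRegularity.
Context {R : realType} {n m : nat}.

(** Solvability of [F x *m C = 0] near approximate solutions.  [B] inverts the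
    linearisation [J *m C] on the row space of [C]; a minimiser of
    [`|F y *m C| + c * `|y - x|] must solve the equation, since otherwise the
    Newton step [y - F y *m C *m B] would decrease this function. *)
Lemma metric_regularity (F : 'rV[R]_n -> 'rV[R]_m) (J : 'M[R]_(n, m))
    (C : 'M[R]_m) (B : 'M[R]_(m, n)) (a : 'rV[R]_n) (r e b : R) :
  0 < r -> 0 < b -> e * b <= 2^-1 ->
  (forall u : 'rV[R]_m, `|u *m B| <= b * `|u|) ->
  (forall u : 'rV[R]_m, u *m C *m B *m J *m C = u *m C) ->
  (forall y, `|y - a| <= r -> {for y, continuous F}) ->
  (forall y z, `|y - a| <= r -> `|z - a| <= r ->
    `|(F y - F z - (y - z) *m J) *m C| <= e * `|y - z|) ->
  forall x, `|x - a| <= r / 2 -> `|F x *m C| <= r / (10 * b) ->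
  exists2 x', F x' *m C = 0 & `|x' - x| <= 4 * b * `|F x *m C|.
Proof.
move=> r0 b0 eb Bb CB cF sF x xa Fx.
pose c : R := (4 * b)^-1; have c0 : 0 < c by rewrite invr_gt0 mulr_gt0.
pose f y := `|F y *m C| + c * `|y - x|.
pose A := [set y : 'rV[R]_n | `|y - a| <= r].
have Ax : A x by apply: (le_trans xa); rewrite ler_pdivrMr//; lra.
have cf : {within A, continuous f}.
  apply: continuous_in_subspaceT => y /set_mem Ay.
  have cy := cF y Ay.
  have c1 : (fun y => F y *m C) @ y --> F y *m C.
    exact: (@cvg_mulmx _ _ _ (nbhs y) _ _ F (cst C) (F y) C cy (cvg_cst _)).
  have c2 : (fun y => y - x) @ y --> y - x.
    by apply: (@cvgB _ _ _ (nbhs y) _ id (cst x)) => //; exact: cvg_cst.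
  have c3 : (fun y => c * `|y - x|) @ y --> c * `|y - x|.
    exact: (@cvgM _ _ (nbhs y) _ _ _ _ _ (cvg_cst c) (cvg_norm c2)).
  exact: (@cvgD _ _ _ (nbhs y) _ _ _ _ _ (cvg_norm c1) c3).
have [y /set_mem Ay ymin] := EVT_min_rV (ex_intro _ x Ax)
  (@closed_ball_compact R n a r) cf.
have fyx : f y <= `|F x *m C|.
  by have := ymin x (mem_set Ax); rewrite {2}/f subrr normr0 mulr0 addr0.
have Fy0 : 0 <= `|F y *m C| by [].
have yx0 : 0 <= `|y - x| by [].
have Fy : `|F y *m C| <= `|F x *m C|.
  by apply: le_trans fyx; rewrite /f lerDl mulr_ge0// ltW.
have yx : `|y - x| <= 4 * b * `|F x *m C|.
  have : c * `|y - x| <= `|F x *m C| by apply: le_trans fyx; rewrite /f lerDr.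
  by rewrite /c ler_pdivrMl// mulr_gt0.
exists y => //; apply/eqP; rewrite -normr_eq0; apply/negPn/negP => Fyn.
have Fyp : 0 < `|F y *m C| by rewrite lt_neqAle eq_sym Fyn.
have [z zE] : exists z, z = y - F y *m C *m B by exists (y - F y *m C *m B).
have zyE : z - y = - (F y *m C *m B) by rewrite zE addrAC subrr sub0r.
have zy : `|z - y| <= b * `|F y *m C| by rewrite zyE normrN.
have bF : b * `|F x *m C| <= r / 10.
  by move: Fx; rewrite invfM mulrA ler_pdivlMr// mulrC.
have Az : A z.
  rewrite /A /=; have -> : z - a = (z - y) + (y - x) + (x - a).
    by rewrite addrA [z - y + _]addrA !subrK.
  apply: (le_trans (ler_normD _ _)).
  apply: (le_trans (lerD (ler_normD _ _) (lexx _))).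
  have : b * `|F y *m C| <= b * `|F x *m C| by rewrite ler_pM2l.
  lra.
have Fz : `|F z *m C| <= 2^-1 * `|F y *m C|.
  have -> : F z *m C = (F z - F y - (z - y) *m J) *m C.
    by rewrite zyE mulNmx opprK mulmxDl mulmxBl CB subrK.
  apply: (le_trans (sF z y Az Ay)).
  have e0 : 0 <= e \/ e < 0 by case: (leP 0 e); [left|right].
  case: e0 => e0; last first.
    apply: (@le_trans _ _ 0); last by rewrite mulr_ge0.
    by rewrite mulr_le0_ge0// ltW.
  apply: (@le_trans _ _ (e * (b * `|F y *m C|))); first by rewrite ler_wpM2l.
  by rewrite mulrA ler_wpM2r.
have := ymin z (mem_set Az); apply/negP; rewrite -ltNge /f.
have : `|z - x| <= b * `|F y *m C| + `|y - x|.
  have -> : z - x = (z - y) + (y - x) by rewrite addrA subrK.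
  by apply: (le_trans (ler_normD _ _)); rewrite lerD2r.
rewrite -(ler_pM2l c0) mulrDr => h.
have cb : c * (b * `|F y *m C|) = 4^-1 * `|F y *m C|.
  by rewrite /c; field; rewrite gt_eqF.
rewrite cb in h; lra.
Qed.

End MetricRegularity.

(** * Composition of a support function with a smooth map *)

Section Decomposed.
Context {R : realType} {n m : nat}.
Variables (phi : 'rV[R]_n -> \bar R) (xbar : 'rV[R]_n).
Variables (Q : set 'rV[R]_m) (F : 'rV[R]_n -> 'rV[R]_m) (lbar : 'rV[R]_m).
Variable U : set 'rV[R]_n.
Hypothesis (Uo : open U) (Ux : U xbar).
Hypothesis C2F : forall i, C2_on U (fun x => F x ord0 i).
Hypothesis phixbar : phi xbar \is a fin_num.
Hypothesis phiE : forall x, U x -> phi x = (phi xbar + support Q (F x))%E.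
Hypothesis F0 : F xbar = 0.
Hypothesis cQ : convex_set Q.
Hypothesis Qlbar : Q lbar.
Local Notation N := (normal_cone Q lbar).
Local Notation G := (smallest_exposed_face Q lbar).
Local Notation J := ('J F xbar).
Hypothesis strictCQ : forall z, exists w y, N y /\ z = w *m J - y.
(** The kernel of [C] is the linear span of the normal cone. *)
Variables (k : nat) (V : 'M[R]_(k, m)).
Hypothesis NV : forall i, N (row i V).
Hypothesis spanV : forall y, N y -> (y <= V)%MS.
Local Notation C := (cokermx V).

Lemma normal_cokermx y : N y -> y *m C = 0.
Proof. by move=> /spanV; rewrite submxE => /eqP. Qed.

(** The strict constraint qualification: the range of [J] and the span of [N]
    together fill the space. *)
Lemma linearised_surj : (C <= J *m C)%MS.
Proof.
apply/row_subP => i; rewrite rowE.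
have [w [y [Ny ->]]] := strictCQ (delta_mx ord0 i).
by rewrite mulmxBl (normal_cokermx Ny) subr0 -mulmxA submxMl.
Qed.

Lemma vector_strict_diff (e : R) : 0 < e -> exists2 r : R, 0 < r &
  forall y z, `|y - xbar| < r -> `|z - xbar| < r ->
    `|F y - F z - (y - z) *m J| <= e * `|y - z|.
Proof.
move=> e0.
have h : \forall r \near (0 : R)^'+, forall i y z, `|y - xbar| < r ->
    `|z - xbar| < r -> `|(F y - F z - (y - z) *m J) ord0 i| <= e * `|y - z|.
  apply: filter_forall => i.
  have cg : {for xbar, continuous (grad (fun x => F x ord0 i))}.
    by have [_ dg _] := C2F i Ux; exact: differentiable_continuous.
  have [r r0 hr] := strict_diff e0 (C2_near_diff Uo C2F i Ux) cg.
  apply: filterS (nbhs_right_le r0) => r' r'r y z yr zr.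
  have sub3 (a b c : 'rV[R]_m) :
    (a - b - c) ord0 i = a ord0 i - b ord0 i - c ord0 i by rewrite !mxE.
  rewrite sub3 (C2_jacobian C2F _ _ Ux).
  by apply: hr; [exact: lt_le_trans yr _|exact: lt_le_trans zr _].
have [r [r0 hr]] := filter_ex (filterI (nbhs_right_gt 0) h).
exists r => // y z yr zr; apply: norm_row_le => [|i]; first by rewrite mulr_ge0// ltW.
exact: hr.
Qed.

Lemma exists_right_inverse : exists (B : 'M[R]_(m, n)),
  forall u : 'rV[R]_m, u *m C *m B *m J *m C = u *m C.
Proof.
exists (pinvmx (J *m C)) => u; rewrite -[_ *m J *m C]mulmxA mulmxKpV//.
by rewrite (submx_trans (submxMl _ _) linearised_surj).
Qed.

(** The constraint [F x *m C = 0] says that [F x] lies in the span of [N].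
    Intersecting with the span, instead of the cone, turns the constraint
    qualification into surjectivity of a linear map. *)
Lemma constraint_regularity : exists r K : R, [/\ 0 < r, 0 < K &
  forall x, `|x - xbar| < r -> U x /\
    exists2 x', F x' *m C = 0 & `|x' - x| <= K * `|F x *m C|].
Proof.
have [B BC] := exists_right_inverse.
have [b b0 Bb] := mulmx_bound B; have [c c0 Cc] := mulmx_bound C.
have e0 : 0 < (2 * b * c)^-1 by rewrite invr_gt0 !mulr_gt0.
have [r1 r10 h1] := vector_strict_diff e0.
have /nbhs_ballP[r2 /= r20 hU] : nbhs xbar U by exact: open_nbhs_nbhs.
pose r := Num.min r1 r2 / 2.
have r12 : 0 < Num.min r1 r2 by rewrite lt_min r10.
have r0 : 0 < r by rewrite divr_gt0.
have rlt : r < Num.min r1 r2 by rewrite /r ltr_pdivrMr//; lra.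
move: (rlt); rewrite lt_min => /andP[rr1 rr2].
have inU y : `|y - xbar| <= r -> U y.
  move=> yr; apply: hU; rewrite -ball_normE /= distrC.
  exact: le_lt_trans yr rr2.
have cF y : `|y - xbar| <= r -> {for y, continuous F}.
  by move=> /inU Uy; exact: differentiable_continuous (C2_diff C2F Uy).
have reg := @metric_regularity R n m F J C B xbar r (2 * b)^-1 b r0 b0.
have sF y z : `|y - xbar| <= r -> `|z - xbar| <= r ->
    `|(F y - F z - (y - z) *m J) *m C| <= (2 * b)^-1 * `|y - z|.
  move=> yr zr; apply: (le_trans (Cc _)).
  apply: (@le_trans _ _ (c * ((2 * b * c)^-1 * `|y - z|))).
    by rewrite ler_pM2l// h1// (le_lt_trans _ rr1).
  by rewrite le_eqVlt; apply/orP; left; apply/eqP; field; rewrite !gt_eqF.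
have eb : (2 * b)^-1 * b <= 2^-1.
  by rewrite le_eqVlt; apply/orP; left; apply/eqP; field; rewrite gt_eqF.
have /cvgrPdist_le : (fun x => F x *m C) @ xbar --> F xbar *m C.
  have cx : {for xbar, continuous F} by apply: cF; rewrite subrr normr0 ltW.
  exact: (@cvg_mulmx _ _ _ (nbhs xbar) _ _ F (cst C) _ C cx (cvg_cst _)).
have d0 : 0 < r / (10 * b) by rewrite divr_gt0// mulr_gt0.
move=> /(_ _ d0) /nbhs_ballP[r3 /= r30 h3].
exists (Num.min (r / 2) r3), (4 * b); split.
- by rewrite lt_min r30 divr_gt0.
- by rewrite mulr_gt0.
move=> x; rewrite lt_min => /andP[xr xr3]; split.
  by apply: inU; rewrite (le_trans (ltW xr))// ler_pdivrMr//; lra.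
apply: reg => //; first exact: ltW.
have := h3 x; rewrite F0 mul0mx sub0r normrN; apply.
by rewrite -ball_normE /= distrC.
Qed.

(** The points [x + t j *: w] satisfy the constraint up to [o(t j)], hence so is
    their distance to the solutions provided by regularity. *)
Lemma feasible_path r K x (w : 'rV[R]_n) (t : nat -> R) :
  (forall x, `|x - xbar| < r -> U x /\
    exists2 x', F x' *m C = 0 & `|x' - x| <= K * `|F x *m C|) ->
  0 < K -> `|x - xbar| < r -> F x *m C = 0 -> w *m 'J F x *m C = 0 -> decr0 t ->
  exists2 w_ : nat -> 'rV[R]_n, w_ @ \oo --> w &
    \forall j \near \oo, F (x + t j *: w_ j) *m C = 0.
Proof.
move=> reg K0 xr FxC wC td; have [t0 tcvg] := td.
have [Ux' _] := reg x xr.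
have tw : (fun j => x + t j *: w) @ \oo --> x.
  exact: (@cvg_path _ _ t (fun=> w) x w td (cvg_cst w)).
have c1 : (fun j => (t j)^-1 *: (F (x + t j *: w) - F x) *m C) @ \oo --> (0 : 'rV[R]_m).
  rewrite -wC.
  have c := @cvg_diffquo1 _ _ _ F t (fun=> w) x w (C2_diff C2F Ux') td (cvg_cst w).
  have c' : (fun j => (t j)^-1 *: (F (x + t j *: w) - F x)) @ \oo --> w *m 'J F x.
    exact: c.
  exact: (@cvg_mulmx _ _ _ \oo _ _ _ (cst C) _ C c' (cvg_cst _)).
have /choice[x_ hx] : forall j, exists y, `|x + t j *: w - xbar| < r ->
    F y *m C = 0 /\ `|y - (x + t j *: w)| <= K * `|F (x + t j *: w) *m C|.
  move=> j.
  have [/reg[_ [y Fy yx]]|_] := ltP `|x + t j *: w - xbar| r; first by exists y.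
  by exists 0.
have tr : \forall j \near \oo, `|x + t j *: w - xbar| < r.
  have c : (fun j => x + t j *: w - xbar) @ \oo --> x - xbar.
    by apply: cvgB => //; exact: cvg_cst.
  have c' : (fun j => `|x + t j *: w - xbar|) @ \oo --> `|x - xbar|.
    exact: cvg_norm c.
  exact: (cvgr_lt _ c' _ xr).
exists (fun j => (t j)^-1 *: (x_ j - x)).
  apply/cvgrPdistC_le => e e0.
  have eK : 0 < e / K by rewrite divr_gt0.
  have /cvgrPdistC_le /(_ _ eK) c2 := c1.
  apply: filterS2 tr c2 => j xj; rewrite subr0 -scalemxAl mulmxBl FxC subr0 => h.
  have [_ hj] := hx j xj.
  have -> : (t j)^-1 *: (x_ j - x) - w = (t j)^-1 *: (x_ j - (x + t j *: w)).
    by rewrite opprD addrA [in RHS]scalerBr scalerA mulVf ?gt_eqF// scale1r.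
  rewrite normrZ; apply: (@le_trans _ _ (`|(t j)^-1| * (K * `|F (x + t j *: w) *m C|))).
    by rewrite ler_wpM2l.
  by rewrite mulrCA -normrZ -ler_pdivlMl// mulrC.
apply: filterS tr => j xj; have [h _] := hx j xj.
by rewrite scalerA divff ?gt_eqF// scale1r addrC subrK.
Qed.

Lemma exists_relint_direction : exists w0 : 'rV[R]_n, relint N (w0 *m J).
Proof.
have [|y0 y0N] := relint_nonempty (convex_normal_cone Qlbar).
  by exists 0; exact: normal_cone0.
have [w [y [Ny y0E]]] := strictCQ y0.
exists w; have -> : w *m J = y0 + y by rewrite y0E subrK.
exact: relint_normal_coneD.
Qed.

(** If [w0 *m J] is in the relative interior of [N], then so is
    [(w0 + s *: w) *m J] for small [s], whenever [w *m J] is in the span of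
    [N]. *)
Lemma affine_hull_critical (w : 'rV[R]_n) :
  affine_hull [set w : 'rV[R]_n | N (w *m J)] w <-> w *m J *m C = 0.
Proof.
split=> [wS|wC].
  rewrite -mulmxA; apply: affine_hull_sub wS => y /= Ny.
  by rewrite mulmxA normal_cokermx.
have [w0 w0N] := exists_relint_direction; have [N0 _] := w0N.
have td := @decr0_harmonic R.
have cw : (fun j : nat => w0 *m J + j.+1%:R^-1 *: (w *m J)) @ \oo --> w0 *m J.
  exact: (@cvg_path _ _ _ (fun=> w *m J) (w0 *m J) (w *m J) td (cvg_cst _)).
have cN : \forall j \near \oo, ((w0 *m J + j.+1%:R^-1 *: (w *m J))%R <= V)%MS ->
    relint N (w0 *m J + j.+1%:R^-1 *: (w *m J)).
  exact: (cw _ (relint_normal_cone_near Qlbar NV w0N)).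
have [j [hs j0]] := filter_ex (filterI cN (nbhs_infty_gt 0)).
set s : R := j.+1%:R^-1 in hs.
have s0 : 0 < s by rewrite invr_gt0 ltr0n.
have s1 : s < 1 by rewrite invf_lt1 ?ltr0n// ltr1n ltnS.
have Nw : N ((w0 + s *: w) *m J).
  rewrite mulmxDl -scalemxAl; have [|//] := hs.
  by apply: addmx_sub; [exact: spanV|rewrite scalemx_sub// submxE wC].
(* [w] lies on the line through the two critical directions [w0 + s *: w] and
   [(1 - s)^-1 *: w0]. *)
have -> : w = s^-1 *: (w0 + s *: w) + (1 - s^-1) *: ((1 - s)^-1 *: w0).
  have s1' : 1 - s != 0 by rewrite subr_eq0 gt_eqF.
  by apply/rowP => i; rewrite !mxE; field; rewrite s1' gt_eqF.
apply: affine_hull_affine; first exact: sub_affine_hull.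
by rewrite /= -scalemxAl; apply: normal_coneZ => //; rewrite invr_ge0 subr_ge0 ltW.
Qed.

(** On a feasible curve with velocity [w0], the vectors [(t j)^-1 *: F (x j)] lie
    in the span of [N] and tend to the relative interior point [w0 *m J]. *)
Lemma exists_near_relint (W : set 'rV[R]_n) : nbhs xbar W ->
  exists2 x, W x & relint N (F x).
Proof.
move=> xW; have [r [K [r0 K0 reg]]] := constraint_regularity.
have [w0 w0N] := exists_relint_direction; have [N0 _] := w0N.
have td := @decr0_harmonic R; have [t0 _] := td.
have xr : `|xbar - xbar| < r by rewrite subrr normr0.
have FC : F xbar *m C = 0 by rewrite F0 mul0mx.
have [w_ ww wF] := feasible_path reg K0 xr FC (normal_cokermx N0) td.
have xW' : \forall j \near \oo, W (xbar + j.+1%:R^-1 *: w_ j).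
  exact: (cvg_path td ww xW).
have cN : \forall j \near \oo,
    (((j.+1%:R^-1)^-1 *: (F (xbar + j.+1%:R^-1 *: w_ j) - F xbar))%R <= V)%MS ->
    relint N ((j.+1%:R^-1)^-1 *: (F (xbar + j.+1%:R^-1 *: w_ j) - F xbar)).
  exact: (cvg_diffquo1 (C2_diff C2F Ux) td ww (relint_normal_cone_near Qlbar NV w0N)).
have [j [[Wj Fj] Nj]] := filter_ex (filterI (filterI xW' wF) cN).
exists (xbar + j.+1%:R^-1 *: w_ j) => //.
have -> : F (xbar + j.+1%:R^-1 *: w_ j) =
    j.+1%:R^-1 *: ((j.+1%:R^-1)^-1 *: F (xbar + j.+1%:R^-1 *: w_ j)).
  by rewrite scalerKV// lt0r_neq0.
apply: relint_normal_coneZ; [exact: Qlbar|exact: t0|].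
by move: Nj; rewrite F0 subr0; apply; rewrite scalemx_sub// submxE; apply/eqP.
Qed.

Lemma exists_near_face (W : set 'rV[R]_m) : nbhs lbar W ->
  exists2 l, W l & relint G l.
Proof.
move=> lW; have cG : convex_set G by exact: convex_face.
have [|l0 l0G] := relint_nonempty cG; first by exists lbar; exact: face_self.
have c : (fun j : nat => (1 - j.+1%:R^-1) *: lbar + j.+1%:R^-1 *: l0) @ \oo --> lbar.
  have [_ h] := @decr0_harmonic R.
  have e : (1 - 0) *: lbar + 0 *: l0 = lbar by rewrite subr0 scale1r scale0r addr0.
  rewrite -[X in _ --> X]e; apply: cvgD; apply: cvgZr_tmp => //.
  by apply: cvgB => //; exact: cvg_cst.
have [j _ /(_ j (leqnn j)) Wj] := c _ lW.
exists ((1 - j.+1%:R^-1) *: lbar + j.+1%:R^-1 *: l0) => //.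
apply: relint_segment => //; first exact: face_self.
by rewrite invr_gt0 ltr0n/= invf_le1 ?ltr0n// ler1n.
Qed.

Lemma phi_diffquo x y l (t : R) (w : 'rV[R]_n) : U x -> U y -> y = x + t *: w ->
  support Q (F x) = (dot l (F x))%:E ->
  diffquo2 phi x (l *m ('J F x)^T) t w =
  ((t ^+ 2 / 2)^-1%:E * (support Q (F y) -
     (dot l (F x) + dot l ((t *: w) *m 'J F x))%:E))%E.
Proof.
move=> Ux' Uy yE sx; rewrite /diffquo2 -yE (phiE Uy) (phiE Ux') sx -(fineK phixbar).
congr (_ * _)%E; rewrite dot_mulmx trmxK -scalemxAl dotZr.
case: (support Q (F y)) => [s| |] //.
by rewrite -!(EFinD, EFinN); congr EFin; ring.
Qed.

(** Near a relative interior point of [N] a feasible curve is mapped into [N],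
    where the support function is linear with slope [l]. *)
Lemma second_subderiv_upper r K x l g (w : 'rV[R]_n) :
  (forall x, `|x - xbar| < r -> U x /\
    exists2 x', F x' *m C = 0 & `|x' - x| <= K * `|F x *m C|) ->
  0 < K -> `|x - xbar| < r -> relint N (F x) -> G l ->
  (forall t : nat -> R, decr0 t ->
    epi_cvg (fun j => diffquo2 phi x (l *m ('J F x)^T) (t j)) g) ->
  w *m 'J F x *m C = 0 -> (g w <= (dot w (w *m hessL F x l))%:E)%E.
Proof.
move=> reg K0 xr xN Gl epi wC; have [Ux' _] := reg x xr; have [Nx _] := xN.
have td := @decr0_harmonic R; have [t0 _] := td.
have [w_ ww wF] := feasible_path reg K0 xr (normal_cokermx Nx) wC td.
have [/(_ w_ ww) ge_g _] := epi _ td w; apply: (le_trans ge_g).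
apply: (le_trans (limn_einf_sup _)).
apply: (limn_esup_le_cvgr (cvg_diffquo2 Uo C2F (l := l) Ux' td ww)).
have cp : (fun j => x + j.+1%:R^-1 *: w_ j) @ \oo --> x by exact: cvg_path td ww.
have Uj : \forall j \near \oo, U (x + j.+1%:R^-1 *: w_ j).
  have xU : nbhs x U by exact: open_nbhs_nbhs.
  exact: (cp _ xU).
have Nj : \forall j \near \oo, F (x + j.+1%:R^-1 *: w_ j) *m C = 0 ->
    N (F (x + j.+1%:R^-1 *: w_ j)).
  have cF : (fun j => F (x + j.+1%:R^-1 *: w_ j)) @ \oo --> F x.
    exact: cvg_comp cp (differentiable_continuous (C2_diff C2F Ux')).
  have cN : \forall j \near \oo, (F (x + j.+1%:R^-1 *: w_ j) <= V)%MS ->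
      relint N (F (x + j.+1%:R^-1 *: w_ j)).
    exact: (cF _ (relint_normal_cone_near Qlbar NV xN)).
  by apply: filterS cN => j h FC; have [|//] := h; rewrite submxE FC.
apply: filterS3 wF Uj Nj => j Fj Uj /(_ Fj) Nj.
rewrite (phi_diffquo Ux' Uj erefl (support_face Qlbar Nx Gl)).
rewrite (support_face Qlbar Nj Gl) -EFinB -EFinM lee_fin.
by rewrite !dotBr opprD addrA.
Qed.

(** The support function is compared with the linear form of a point of [Q] on a
    curve through [l] with velocity [p] and acceleration [a].  The second-order
    tangent set provides this curve only along one sequence of times [t j];
    epi-convergence along every sequence makes it legitimate to compute the
    second subderivative with the steps [c * t j].  The free parameter [c] is
    the ratio of the two time scales; [p = a = 0] gives the bound by the
    quadratic form alone. *)
Lemma second_subderiv_lower x l g (w : 'rV[R]_n) (p a : 'rV[R]_m) (c : R) :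
  U x -> Q l -> support Q (F x) = (dot l (F x))%:E -> dot p (F x) = 0 ->
  tangent2 Q l p a -> 0 < c ->
  (forall t : nat -> R, decr0 t ->
    epi_cvg (fun j => diffquo2 phi x (l *m ('J F x)^T) (t j)) g) ->
  ((dot w (w *m hessL F x l) + 2 / c * dot p (w *m 'J F x)
     + dot a (F x) / c ^+ 2)%:E <= g w)%E.
Proof.
move=> Ux' Ql sx px [t td dt] c0 epi; have [t0 tcvg] := td.
pose s j := c * t j.
have sd : decr0 s.
  split=> [j|]; first by rewrite mulr_gt0.
  by rewrite -[X in _ --> X](mulr0 c); apply: cvgM => //; exact: cvg_cst.
have [_ [w_ ww g_ge]] := epi s sd w; apply: le_trans g_ge.
apply: le_trans (limn_einf_sup _).
pose z j := l + t j *: p + (t j ^+ 2 / 2) *: a.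
have /choice[l_ hl] : forall j, exists lj, Q lj /\
    forall d : R, dist (z j) Q = d%:E -> enorm (z j - lj) <= d + t j ^+ 2 * t j.
  move=> j; have [[d dE]|nd] := pselect (exists d : R, dist (z j) Q = d%:E); last first.
    by exists l; split => // d dE; case: nd; exists d.
  have : (dist (z j) Q < (d + t j ^+ 2 * t j)%:E)%E.
    by rewrite dE lte_fin ltrDl mulr_gt0// exprn_gt0.
  move=> /ereal_inf_lt[_ [lj Qlj <-]]; rewrite lte_fin => h.
  by exists lj; split => // d'; rewrite dE => -[<-]; exact: ltW.
(* [l_ j] is a point of [Q] that nearly realises the distance from [z j]. *)
pose q j := (t j ^+ 2)^-1 *: (z j - l_ j).
have qc : q @ \oo --> (0 : 'rV[R]_m).
  have [dfin dcvg] := (fine_cvgP _ _).1 dt.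
  have dc : (fun j => fine ((t j ^+ 2)^-1%:E * dist (z j) Q)%E + t j) @ \oo --> (0 : R).
    rewrite -[X in _ --> X](addr0 0); apply: cvgD; first exact: dcvg.
    exact: tcvg.
  apply/cvgrPdistC_le => e e0.
  have dle : \forall j \near \oo, fine ((t j ^+ 2)^-1%:E * dist (z j) Q)%E + t j <= e.
    exact: (cvgr_le _ dc).
  apply: filterS2 dfin dle => j dj {}dle; rewrite subr0.
  have t2 : 0 < t j ^+ 2 by rewrite exprn_gt0.
  have [d dE] : exists d : R, dist (z j) Q = d%:E.
    move: dj; case: (dist (z j) Q) => [d _| |]; first by exists d.
      by rewrite gt0_muley// lte_fin invr_gt0.
    by rewrite gt0_muleNy// lte_fin invr_gt0.
  have [_ /(_ d dE) h] := hl j.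
  rewrite /q normrZ gtr0_norm ?invr_gt0// ler_pdivrMl//.
  apply: (le_trans (norm_le_enorm _)); apply: (le_trans h).
  by move: dle; rewrite dE -EFinM /= -(ler_pM2l t2) mulrDr mulVKf// gt_eqF.
have lE j : l_ j - l = t j *: p + (t j ^+ 2 / 2) *: a - (t j ^+ 2) *: q j.
  rewrite /q scalerA divff ?scale1r; last by rewrite gt_eqF// exprn_gt0.
  by rewrite /z; apply/rowP => i; rewrite !mxE; ring.
pose D j := (s j)^-1 *: (F (x + s j *: w_ j) - F x).
have Dc : D @ \oo --> w *m 'J F x by exact: cvg_diffquo1 (C2_diff C2F Ux') sd ww.
have cp : (fun j => x + s j *: w_ j) @ \oo --> x by exact: cvg_path sd ww.
have Fc : (fun j => F (x + s j *: w_ j)) @ \oo --> F x.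
  exact: cvg_comp cp (differentiable_continuous (C2_diff C2F Ux')).
have c1 : (fun j => (s j ^+ 2 / 2)^-1 *
      dot l (F (x + s j *: w_ j) - F x - (s j *: w_ j) *m 'J F x)) @ \oo -->
    dot w (w *m hessL F x l).
  exact: (cvg_diffquo2 Uo C2F (l := l) Ux' sd ww).
have c2 : (fun j => 2 / c * dot p (D j)) @ \oo --> 2 / c * dot p (w *m 'J F x).
  apply: cvgM; first exact: cvg_cst.
  exact: (@cvg_dot _ _ _ \oo _ (fun=> p) _ _ _ (cvg_cst _) Dc).
have c3 : (fun j => dot a (F (x + s j *: w_ j)) / c ^+ 2) @ \oo --> dot a (F x) / c ^+ 2.
  apply: cvgM; last exact: cvg_cst.
  exact: (@cvg_dot _ _ _ \oo _ (fun=> a) _ _ _ (cvg_cst _) Fc).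
have c4 : (fun j => 2 / c ^+ 2 * dot (q j) (F (x + s j *: w_ j))) @ \oo --> (0 : R).
  have h : (fun j => 2 / c ^+ 2 * dot (q j) (F (x + s j *: w_ j))) @ \oo -->
      2 / c ^+ 2 * dot 0 (F x).
    by apply: cvgM; [exact: cvg_cst|exact: (cvg_dot qc Fc)].
  by rewrite dot0l mulr0 in h.
have bc : (fun j => (s j ^+ 2 / 2)^-1 *
      dot l (F (x + s j *: w_ j) - F x - (s j *: w_ j) *m 'J F x)
    + 2 / c * dot p (D j) + dot a (F (x + s j *: w_ j)) / c ^+ 2
    - 2 / c ^+ 2 * dot (q j) (F (x + s j *: w_ j))) @ \oo -->
    dot w (w *m hessL F x l) + 2 / c * dot p (w *m 'J F x)
     + dot a (F x) / c ^+ 2.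
  rewrite -[X in _ --> X]subr0.
  by apply: cvgB => //; apply: cvgD => //; apply: cvgD.
apply: (limn_einf_ge_cvg bc).
have Uj : \forall j \near \oo, U (x + s j *: w_ j).
  have xU : nbhs x U by exact: open_nbhs_nbhs.
  exact: (cp _ xU).
apply: filterS Uj => j Uj.
rewrite (phi_diffquo Ux' Uj erefl sx).
have [Qlj _] := hl j.
have s0 : 0 < s j by rewrite mulr_gt0.
have s2 : 0 < (s j ^+ 2 / 2)^-1 by rewrite invr_gt0 divr_gt0// exprn_gt0.
apply: (@le_trans _ _ ((s j ^+ 2 / 2)^-1%:E * ((dot (l_ j) (F (x + s j *: w_ j)))%:E
    - (dot l (F x) + dot l ((s j *: w_ j) *m 'J F x))%:E))%E); last first.
  by rewrite lee_pmul2l ?lte_fin// leeD2r// support_ge.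
have FD : F (x + s j *: w_ j) = F x + s j *: D j.
  by rewrite /D scalerA divff ?gt_eqF// scale1r [RHS]addrC subrK.
have -> : l_ j = l + (l_ j - l) by rewrite addrC subrK.
rewrite -EFinB -EFinM lee_fin lE le_eqVlt; apply/orP; left; apply/eqP.
have pF : dot p (F (x + s j *: w_ j)) = s j * dot p (D j).
  by rewrite FD dotDr px add0r dotZr.
move: (F (x + s j *: w_ j)) ((s j *: w_ j) *m 'J F x) pF => Fj wj.
rewrite /s; move: (q j) (D j) => qj Dj pF.
rewrite !dotlin pF; field.
by rewrite !gt_eqF.
Qed.

(** Off the affine hull of the critical cone the second subderivatives explode:
    some multiplier direction of the path property sees the component of
    [w *m J] normal to the span of [N], while the acceleration term is damped
    because [F (x_ j)] tends to [0]. *)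
Lemma second_subderiv_blowup (x_ : nat -> 'rV[R]_n) (l_ : nat -> 'rV[R]_m)
    (g_ : nat -> 'rV[R]_n -> \bar R) (w_ : nat -> 'rV[R]_n) (w : 'rV[R]_n) :
  tangent_path_property Q lbar -> x_ @ \oo --> xbar -> l_ @ \oo --> lbar ->
  (forall j, U (x_ j)) -> (forall j, N (F (x_ j))) -> (forall j, G (l_ j)) ->
  (forall j (t : nat -> R), decr0 t ->
    epi_cvg (fun i => diffquo2 phi (x_ j) (l_ j *m ('J F (x_ j))^T) (t i)) (g_ j)) ->
  w_ @ \oo --> w -> w *m J *m C <> 0 ->
  limn_einf (fun j => g_ j (w_ j)) = +oo%E.
Proof.
move=> [M [V' [L [M0 V'n Lsub [_ inner] Lt2]]]] xx ll Uj Nj Gj epi ww wC.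
(* [p] is, up to a factor, the column of [C] that detects [w *m J]; the factor
   makes the product positive. *)
have [p [pN pw]] : exists p, (forall y, N y -> dot p y = 0) /\ 0 < dot p (w *m J).
  have /rowP/existsNP[j hj] := wC.
  have colE (y : 'rV[R]_m) : dot (row j C^T) y = (y *m C) ord0 j.
    by rewrite dotC [RHS]mxE; apply: eq_bigr => i _; rewrite [row _ _ _ _]mxE [_^T _ _]mxE.
  exists ((w *m J *m C) ord0 j *: row j C^T); split.
    by move=> y Ny; rewrite dotZl colE (normal_cokermx Ny) [X in _ * X]mxE mulr0.
  rewrite dotZl colE -expr2 exprn_even_gt0//=.
  by apply/eqP => h; apply: hj; rewrite h [RHS]mxE.
have : inner_limit (Q `&` V') (fun l => [set` L l]) lbar p.
  by rewrite inner; apply: orth_normal_lineality.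
(* The path property speaks of multipliers in [V'], which contains [l_ j] only
   eventually. *)
pose l' j := if `[< V' (l_ j) >] then l_ j else lbar.
have l'QV j : (Q `&` V') (l' j).
  rewrite /l'; case: asboolP => // h; last by split => //; exact: nbhs_singleton.
  by split => //; have [] := Gj j.
have l'c : l' @ \oo --> lbar.
  apply/cvgrPdist_lt => e e0.
  have : \forall j \near \oo, `|lbar - l_ j| < e by exact: cvgr_dist_lt.
  by apply: filterS => j hj; rewrite /l'; case: ifP => // _; rewrite subrr normr0.
move=> /(_ l' l'QV l'c)[p_ pL pp].
have p0 : 0 < enorm p.
  rewrite lt_neqAle enorm_ge0 andbT eq_sym enorm_eq0.
  by apply: contraTneq pw => ->; rewrite dot0l ltxx.
have ep : (fun j => enorm (p_ j)) @ \oo --> enorm p by exact: cvg_enorm.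
pose u_ j := (enorm (p_ j))^-1 *: p_ j; pose u := (enorm p)^-1 *: p.
have uc : u_ @ \oo --> u.
  by apply: cvgZ => //; apply: cvgV => //; rewrite gt_eqF.
have uw : 0 < dot u (w *m J) by rewrite dotZl mulr_gt0// invr_gt0.
set h0 := dot w (w *m hessL F xbar lbar).
have Jc : (fun j => w_ j *m 'J F (x_ j)) @ \oo --> w *m J.
  exact: (cvg_mulmx ww (cvg_jacobian C2F Ux Uj xx)).
have Hc : (fun j => dot (w_ j) (w_ j *m hessL F (x_ j) (l_ j))) @ \oo --> h0.
  exact: (cvg_dot ww (cvg_mulmx ww (cvg_hessL C2F Ux xx ll))).
have Fc : (fun j => enorm (F (x_ j))) @ \oo --> (0 : R).
  have c : (fun j => F (x_ j)) @ \oo --> F xbar.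
    exact: cvg_comp xx (differentiable_continuous (C2_diff C2F Ux)).
  have <- : enorm (F xbar) = 0 by apply/eqP; rewrite enorm_eq0 F0.
  exact: cvg_enorm c.
(* The constant [c] makes the velocity term exceed [A - h0]. *)
apply/eqyP => A A0.
pose c := 2 * dot u (w *m J) / (`|A - h0| + 1).
have c0 : 0 < c by rewrite divr_gt0 ?mulr_gt0// ltr_wpDl.
have bc : (fun j => dot (w_ j) (w_ j *m hessL F (x_ j) (l_ j))
     + 2 / c * dot (u_ j) (w_ j *m 'J F (x_ j)) - M * enorm (F (x_ j)) / c ^+ 2)
   @ \oo --> h0 + 2 / c * dot u (w *m J) - M * 0 / c ^+ 2.
  have c1 : (fun j => 2 / c * dot (u_ j) (w_ j *m 'J F (x_ j))) @ \oo -->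
      2 / c * dot u (w *m J).
    by apply: cvgM; [exact: cvg_cst|exact: (cvg_dot uc Jc)].
  have c2 : (fun j => M * enorm (F (x_ j)) / c ^+ 2) @ \oo --> M * 0 / c ^+ 2.
    by apply: cvgM; [apply: cvgM => //; exact: cvg_cst|exact: cvg_cst].
  by apply: cvgB => //; exact: cvgD.
apply: (@le_trans _ _ (h0 + 2 / c * dot u (w *m J) - M * 0 / c ^+ 2)%:E).
  have -> : 2 / c * dot u (w *m J) = `|A - h0| + 1.
    by rewrite /c; field; rewrite !gt_eqF// ltr_wpDl.
  rewrite mulr0 mul0r subr0 lee_fin addrA -lerBlDr -lerBlDl.
  have := ler_norm (A - h0); lra.
apply: (limn_einf_ge_cvg bc).
have V'j : \forall j \near \oo, V' (l_ j) by exact: (ll _ V'n).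
have pj0 : \forall j \near \oo, 0 < enorm (p_ j) by exact: (cvgr_gt _ ep).
apply: filterS3 V'j pj0 pL => j Vj pj pLj.
have l'E : l' j = l_ j by rewrite /l' asboolT.
have Qj : Q (l_ j) by have [] := Gj j.
have pLj' : p_ j \in L (l_ j) by rewrite -l'E.
have uL : u_ j \in L (l_ j) by exact: memvZ.
have u1 : enorm (u_ j) = 1.
  by rewrite enormZ gtr0_norm ?invr_gt0// mulVf// gt_eqF.
have /ereal_inf_lt[_ [a aT <-]] := Lt2 _ _ (conj Qj Vj) uL u1.
rewrite lte_fin sub0r enormN => aM.
have uF : dot (u_ j) (F (x_ j)) = 0.
  apply: (lineality_tangent_orth (Q := Q) (l := l_ j)) => //.
    by apply: (Lsub _ (conj Qj Vj)); exact: uL.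
  exact: (normal_cone_face Qlbar (Nj j) (Gj j)).
have := second_subderiv_lower (w_ j) (Uj j) Qj
  (support_face Qlbar (Nj j) (Gj j)) uF aT c0 (epi j).
apply: le_trans; rewrite lee_fin lerD2l -mulNr ler_pM2r ?invr_gt0 ?exprn_gt0//.
rewrite -[leRHS]opprK lerN2 -dotNl; apply: (le_trans (dot_le _ _)).
by rewrite enormN ler_wpM2r ?enorm_ge0// ltW.
Qed.

End Decomposed.

(** * Orthogonal projections *)

Section OrthProj.
Context {R : realType} {n p : nat}.
Variable K : 'M[R]_(n, p).
Local Notation L := [set w : 'rV[R]_n | w *m K = 0].

(** The kernel of [K] and its orthogonal complement have trivial intersection
    and complementary dimensions, so projecting along the latter is orthogonal
    and the choice made in [orth_proj] is meaningful. *)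
Lemma orth_proj_kernel : is_orth_proj L (orth_proj L).
Proof.
apply: (@getPex _ (is_orth_proj L)).
pose A := kermx K; pose B := kermx A^T.
have AB0 : (A :&: B)%MS = 0.
  apply/eqP; rewrite -submx0; apply/row_subP => i.
  have : (row i (A :&: B)%MS <= A :&: B)%MS by exact: row_sub.
  move: (row i _) => u; rewrite sub_capmx => /andP[/submxP[a uE] /sub_kermxP uB].
  have : dot u u = 0 by rewrite {2}uE dotC dot_mulmx uB dot0r.
  by move/eqP; rewrite dot_eq0 => /eqP ->; exact: sub0mx.
have full : row_full (A + B)%MS.
  rewrite /row_full mxrank_disjoint_sum// [\rank B]mxrank_ker mxrank_tr subnKC//.
  exact: rank_leq_row.
exists (proj_mx A B) => w; split.
  by apply/sub_kermxP; exact: proj_mx_sub.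
move=> u /sub_kermxP/submxP[a ->].
have /sub_kermxP h : (w - w *m proj_mx A B <= B)%MS.
  by apply: proj_mx_compl_sub; rewrite submx_full.
by rewrite dotC dot_mulmx h dot0r.
Qed.

Lemma orth_proj_quadratic (H : 'M[R]_n) w : w *m K = 0 ->
  dot w (w *m (orth_proj L *m H *m orth_proj L)) = dot w (w *m H).
Proof.
move=> wK; set P := orth_proj L.
have wP : w *m P = w.
  have [wL orth] := orth_proj_kernel w.
  have : dot (w - w *m P) (w - w *m P) = 0.
    by apply: orth; rewrite /= mulmxBl wK wL subrr.
  by move/eqP; rewrite dot_eq0 subr_eq0 => /eqP <-.
rewrite !mulmxA wP.
have [_ /(_ w wK)] := orth_proj_kernel (w *m H).
by rewrite dotBl !(dotC _ w) => /subr0_eq.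
Qed.

End OrthProj.

(** * Subgradients and recovery directions *)

Section Composite.
Context {R : realType} {n m : nat}.

Lemma tangent2_0 (Q : set 'rV[R]_m) l : Q l -> tangent2 Q l 0 0.
Proof.
move=> Ql; exists (fun k => k.+1%:R^-1); first exact: decr0_harmonic.
have d0 : dist l Q = 0%E.
  apply/eqP; rewrite eq_le; apply/andP; split.
    by apply: ereal_inf_lbound; exists l => //; rewrite subrr /enorm dot0l sqrtr0.
  by apply: le_ereal_inf_tmp => _ [q _ <-]; rewrite lee_fin enorm_ge0.
under eq_fun do rewrite !scaler0 !addr0 d0 mule0.
exact: cvg_cst.
Qed.

Lemma regular_subdiff_composite (phi : 'rV[R]_n -> \bar R) (xbar : 'rV[R]_n)
  (Q : set 'rV[R]_m) (F : 'rV[R]_n -> 'rV[R]_m) (U : set 'rV[R]_n) x l :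
  open U -> U x -> differentiable F x -> phi xbar \is a fin_num ->
  (forall x, U x -> phi x = (phi xbar + support Q (F x))%E) ->
  Q l -> support Q (F x) = (dot l (F x))%:E ->
  regular_subdiff phi x (l *m ('J F x)^T).
Proof.
move=> Uo Ux dF phixbar phiE Ql sx; split.
  by rewrite phiE// sx fin_numD phixbar.
move=> e e0.
have d0 : 0 < e / (m%:R * `|l| + 1) by rewrite divr_gt0// ltr_wpDl// mulr_ge0.
have c : (fun y => y - x) @ x --> (0 : 'rV[R]_n).
  rewrite -[X in _ --> X](subrr x).
  by apply: (@cvgB _ _ _ (nbhs x) _ id (cst x)) => //; exact: cvg_cst.
have h1 : \forall y \near x, `|F (x + (y - x)) - F x - 'd F x (y - x)|
    <= e / (m%:R * `|l| + 1) * `|y - x|.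
  exact: (c _ (diff_near dF d0)).
have h2 : \forall y \near x, U y by exact: open_nbhs_nbhs.
apply: filterS2 h1 h2 => y.
have -> : x + (y - x) = y by rewrite addrC subrK.
move=> h Uy.
rewrite (phiE _ Uy) (phiE _ Ux) sx -(fineK phixbar) -addeA leeD2l//.
apply: le_trans (support_ge _ Ql); rewrite -EFinD lee_fin.
have hd : 'd F x (y - x) = (y - x) *m 'J F x by rewrite /jacobian mul_rV_lin1.
rewrite hd in h.
have : `|dot l (F y - F x - (y - x) *m 'J F x)| <= e * enorm (y - x).
  apply: (le_trans (dot_le_norm _ _)).
  apply: (@le_trans _ _ (m%:R * (`|l| * (e / (m%:R * `|l| + 1) * `|y - x|)))).
    by rewrite ler_wpM2l// ler_wpM2l.
  apply: (@le_trans _ _ (e * `|y - x|)); last by rewrite ler_pM2l// norm_le_enorm.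
  have -> : m%:R * (`|l| * (e / (m%:R * `|l| + 1) * `|y - x|)) =
      (m%:R * `|l|) * (e / (m%:R * `|l| + 1)) * `|y - x| by ring.
  rewrite ler_wpM2r// mulrA ler_pdivrMr ?ltr_wpDl ?mulr_ge0//.
  by rewrite mulrC ler_pM2l// lerDl.
have -> : dot (l *m ('J F x)^T) (y - x) = dot l ((y - x) *m 'J F x).
  by rewrite dot_mulmx trmxK.
move: ((y - x) *m 'J F x) => u.
rewrite ler_norml !dotBr => /andP[h3 _]; lra.
Qed.

Lemma limiting_subdiff_regular (phi : 'rV[R]_n -> \bar R) x v :
  regular_subdiff phi x v -> limiting_subdiff phi x v.
Proof.
move=> h; split; first by case: h.
by exists (fun=> x), (fun=> v); split => //; exact: cvg_cst.
Qed.

(** Metric regularity applied to the linear maps [y |-> y *m J_ j], which are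
    eventually as close to their limit as the estimate requires. *)
Lemma cvg_kernel_directions (J_ : nat -> 'M[R]_(n, m)) (J : 'M[R]_(n, m))
    (C : 'M[R]_m) (B : 'M[R]_(m, n)) (w : 'rV[R]_n) :
  (forall u : 'rV[R]_m, u *m C *m B *m J *m C = u *m C) ->
  J_ @ \oo --> J -> w *m J *m C = 0 ->
  exists2 w_ : nat -> 'rV[R]_n, w_ @ \oo --> w &
    \forall j \near \oo, w_ j *m J_ j *m C = 0.
Proof.
move=> BC JJ wC.
have [b b0 Bb] := mulmx_bound B; have [c c0 Cc] := mulmx_bound C.
have wJ : (fun j => w *m J_ j *m C) @ \oo --> (0 : 'rV[R]_m).
  rewrite -wC.
  have h : (fun j => w *m J_ j) @ \oo --> w *m J.
    exact: (@cvg_mulmx _ _ _ \oo _ _ (fun=> w) _ _ _ (cvg_cst _) JJ).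
  exact: (@cvg_mulmx _ _ _ \oo _ _ _ (cst C) _ _ h (cvg_cst _)).
have d0 : 0 < (2 * b * c * (n%:R + 1))^-1 by rewrite invr_gt0 !mulr_gt0// ltr_wpDl.
have b10 : 0 < 1 / (10 * b) by rewrite divr_gt0// mulr_gt0.
have near1 : \forall j \near \oo, `|J_ j - J| <= (2 * b * c * (n%:R + 1))^-1.
  by have /cvgrPdistC_le /(_ _ d0) := JJ.
have near2 : \forall j \near \oo, `|w *m J_ j *m C| <= 1 / (10 * b).
  have /cvgrPdistC_le /(_ _ b10) := wJ.
  by apply: filterS => j; rewrite subr0.
have sol j : `|J_ j - J| <= (2 * b * c * (n%:R + 1))^-1 ->
    `|w *m J_ j *m C| <= 1 / (10 * b) ->
    exists2 w', w' *m J_ j *m C = 0 & `|w' - w| <= 4 * b * `|w *m J_ j *m C|.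
  move=> hJ hw.
  have e1 : (2 * b)^-1 * b <= 2^-1.
    by rewrite le_eqVlt; apply/orP; left; apply/eqP; field; rewrite gt_eqF.
  have cF (y : 'rV[R]_n) : `|y - w| <= 1 ->
      {for y, continuous (fun y : 'rV[R]_n => y *m J_ j)}.
    move=> _.
    exact: (@cvg_mulmx _ _ _ (nbhs y) _ _ id (cst (J_ j)) _ _ cvg_id (cvg_cst _)).
  have sF (y z : 'rV[R]_n) : `|y - w| <= 1 -> `|z - w| <= 1 ->
      `|(y *m J_ j - z *m J_ j - (y - z) *m J) *m C| <= (2 * b)^-1 * `|y - z|.
    move=> _ _; rewrite -mulmxBl -mulmxBr; move: (y - z) => u.
    apply: (le_trans (Cc _)).
    apply: (@le_trans _ _ (c * ((n%:R + 1) * (`|u| * (2 * b * c * (n%:R + 1))^-1)))).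
      rewrite ler_pM2l//; apply: (le_trans (norm_mulmx_le _ _)).
      by rewrite ler_pM ?mulr_ge0 ?lerDl ?ler_wpM2l.
    rewrite le_eqVlt; apply/orP; left; apply/eqP; field.
    by rewrite !gt_eqF ?ltr_wpDl.
  have ww : `|w - w| <= 1 / 2 by rewrite subrr normr0.
  exact: (metric_regularity ltr01 b0 e1 Bb BC cF sF ww hw).
have /choice[w_ hw_] : forall j, exists w', `|J_ j - J| <= (2 * b * c * (n%:R + 1))^-1 ->
    `|w *m J_ j *m C| <= 1 / (10 * b) ->
    w' *m J_ j *m C = 0 /\ `|w' - w| <= 4 * b * `|w *m J_ j *m C|.
  move=> j; have [[h1 h2]|h] := pselect (`|J_ j - J| <= (2 * b * c * (n%:R + 1))^-1 /\
      `|w *m J_ j *m C| <= 1 / (10 * b)).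
    by have [w' ? ?] := sol j h1 h2; exists w'.
  by exists 0 => h1 h2; case: h.
exists w_; last first.
  by apply: filterS2 near1 near2 => j h1 h2; have [] := hw_ j h1 h2.
apply/cvgrPdistC_le => e e0.
have eb : 0 < e / (4 * b) by rewrite divr_gt0// mulr_gt0.
have near3 : \forall j \near \oo, `|w *m J_ j *m C| <= e / (4 * b).
  have /cvgrPdistC_le /(_ _ eb) := wJ.
  by apply: filterS => j; rewrite subr0.
apply: filterS3 near1 near2 near3 => j h1 h2 h3; have [_ h] := hw_ j h1 h2.
by apply: (le_trans h); rewrite mulrC -ler_pdivlMr// mulr_gt0.
Qed.

End Composite.

(** * Generalized quadratic second subderivatives at nearby points *)

Theorem theorem3p14 (R : realType) (n m : nat)
  (f : 'rV[R]_n -> R) (phi : 'rV[R]_n -> \bar R)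
  (xbar vbar : 'rV[R]_n) (tau rho : R)
  (Q : set 'rV[R]_m) (F : 'rV[R]_n -> 'rV[R]_m) (lbar : 'rV[R]_m)
  (hf : C2_on setT f)
  (hphi_proper : proper phi)
  (hphi_lsc : lower_semicontinuous phi)
  (hphi_bounded : prox_bounded phi)
  (hcrit : limiting_subdiff (fun x => ((f x)%:E + phi x)%E) xbar 0)
  (hvbar : vbar = - grad f xbar)
  (htau : 0 < tau)
  (hreg : globally_prox_regular phi xbar vbar rho)
  (htaurho : tau * rho < 1)
  (hdec : C2_strictly_decomposable phi xbar lbar Q F)
  (hlbar : vbar = lbar *m ('J F xbar)^T)
  (hpath : tangent_path_property Q lbar)
  (hprox : \forall z \near (xbar, lbar),
     relint (normal_cone Q lbar) (F z.1) ->
     relint (smallest_exposed_face Q lbar) z.2 ->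
     differentiable (prox tau phi) (z.1 + tau *: (z.2 *m ('J F z.1)^T))) :
  let S := [set w : 'rV[R]_n | normal_cone Q lbar (w *m 'J F xbar)] in
  let P := orth_proj (affine_hull S) in
  let QQ := P *m hessL F xbar lbar *m P in
  exists x_ v_ : nat -> 'rV[R]_n,
    [/\ forall k, limiting_subdiff phi (x_ k) (v_ k),
        x_ @ \oo --> xbar /\ v_ @ \oo --> vbar,
        forall k, twice_epi_differentiable phi (x_ k) (v_ k),
        forall k, generalized_quadratic (subderiv2 phi (x_ k) (v_ k)) &
        epi_cvg (fun k => subderiv2 phi (x_ k) (v_ k))
          (fun w => ((dot w (w *m QQ))%:E + ind (affine_hull S) w)%E)].
Proof.
move=> S P QQ.
have [[hdom [_ cQ _] F0 [U [Uo Ux C2F phiE]] _] Qlbar strict] := hdec.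
have [phi_gtNy _] := hphi_proper.
have phixbar : phi xbar \is a fin_num.
  by rewrite fin_numE phi_gtNy /= lt_eqF.
have strictCQ z : exists w y, normal_cone Q lbar y /\ z = w *m 'J F xbar - y.
  have : setT z by [].
  by rewrite -strict.
have [k [V [_ NV spanV]]] := span_basis (normal_cone Q lbar).
have [r [K [r0 K0 reg]]] := constraint_regularity Uo Ux C2F F0 strictCQ spanV.
have [B BC] := exists_right_inverse strictCQ spanV.
have [_ [e e0 minorant]] := hreg.
have [[Ax Al] [/= Ax_n Al_n] hA] := hprox.
set N := normal_cone Q lbar in strictCQ NV spanV *.
set G := smallest_exposed_face Q lbar.
have /choice[y_ hy] : forall j : nat, exists y, [/\ Ax y, `|y - xbar| < r,
    `|y - xbar| < j.+1%:R^-1 & relint N (F y)].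
  move=> j; pose d := Num.min r j.+1%:R^-1.
  have d0 : 0 < d by rewrite lt_min r0 invr_gt0 ltr0n.
  have [|y [Ay yd] Ny] := exists_near_relint Uo Ux C2F F0 Qlbar strictCQ NV spanV
      (W := Ax `&` [set y | `|y - xbar| < d]).
    apply: filterI => //; apply/nbhs_ballP; exists d => // y.
    by rewrite -ball_normE /= distrC.
  by exists y; move: yd; rewrite /= lt_min => /andP[].
have /choice[m_ hm] : forall j : nat, exists l, [/\ Al l,
    `|l - lbar| < j.+1%:R^-1 & relint G l].
  move=> j; have d0 : 0 < (j.+1%:R^-1 : R) by rewrite invr_gt0 ltr0n.
  have [|l [Al' ld] Gl] := exists_near_face cQ Qlbar
      (W := Al `&` [set y | `|y - lbar| < j.+1%:R^-1]).
    apply: filterI => //; apply/nbhs_ballP; exists j.+1%:R^-1 => // y.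
    by rewrite -ball_normE /= distrC.
  by exists l.
have yc : y_ @ \oo --> xbar by apply: cvg_harmonic_dist => j; have [] := hy j.
have mc : m_ @ \oo --> lbar by apply: cvg_harmonic_dist => j; have [] := hm j.
have Uy j : U (y_ j) by have [_ yr _ _] := hy j; have [] := reg _ yr.
have Ny j : N (F (y_ j)) by have [_ _ _ []] := hy j.
have Gm j : G (m_ j) by have [_ _ []] := hm j.
have sy j : support Q (F (y_ j)) = (dot (m_ j) (F (y_ j)))%:E.
  exact: (support_face Qlbar (Ny j) (Gm j)).
pose u_ j := m_ j *m ('J F (y_ j))^T.
have tr_cvg : (fun j => ('J F (y_ j))^T) @ \oo --> ('J F xbar)^T.
  exact: cvg_trmx (cvg_jacobian C2F Ux Uy yc).
have uc : u_ @ \oo --> vbar by rewrite hlbar; exact: (cvg_mulmx mc tr_cvg).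
have Fyc : (fun j => F (y_ j)) @ \oo --> F xbar.
  exact: cvg_comp yc (differentiable_continuous (C2_diff C2F Ux)).
have subd j : limiting_subdiff phi (y_ j) (u_ j).
  apply: limiting_subdiff_regular.
  have [Qm _] := Gm j.
  exact: (regular_subdiff_composite Uo (Uy j) (C2_diff C2F (Uy j)) phixbar phiE Qm (sy j)).
have phiy j : phi (y_ j) = (phi xbar + (dot (m_ j) (F (y_ j)))%:E)%E.
  by rewrite phiE// sy.
have good : \forall j \near \oo, [/\ enorm (y_ j - xbar) < e,
    enorm (u_ j - vbar) < e & (phi (y_ j) < phi xbar + e%:E)%E].
  have en0 p : enorm (0 : 'rV[R]_p) = 0 by apply/eqP; rewrite enorm_eq0.
  have c1 : (fun j => enorm (y_ j - xbar)) @ \oo --> (0 : R).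
    rewrite -(en0 n) -(subrr xbar); apply: cvg_enorm.
    by apply: cvgB => //; exact: cvg_cst.
  have c2 : (fun j => enorm (u_ j - vbar)) @ \oo --> (0 : R).
    rewrite -(en0 n) -(subrr vbar); apply: cvg_enorm.
    by apply: cvgB => //; exact: cvg_cst.
  have c3 : (fun j => dot (m_ j) (F (y_ j))) @ \oo --> (0 : R).
    by rewrite -(dot0r lbar) -F0; exact: (cvg_dot mc Fyc).
  have h1 : \forall j \near \oo, enorm (y_ j - xbar) < e by exact: (cvgr_lt _ c1).
  have h2 : \forall j \near \oo, enorm (u_ j - vbar) < e by exact: (cvgr_lt _ c2).
  have h3 : \forall j \near \oo, dot (m_ j) (F (y_ j)) < e by exact: (cvgr_lt _ c3).
  by apply: filterS3 h1 h2 h3 => j ? ? h; split => //; rewrite phiy lteD2lE.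
(* The prox-regularity inequality is available only from some index [j0] on. *)
have [j0 _ good'] := good.
pose x_ j := y_ (j + j0)%N; pose l_ j := m_ (j + j0)%N.
pose v_ j := l_ j *m ('J F (x_ j))^T.
have xc : x_ @ \oo --> xbar by rewrite cvg_shiftn.
have lc : l_ @ \oo --> lbar by rewrite cvg_shiftn.
have vc : v_ @ \oo --> vbar.
  have -> : v_ = (fun j => u_ (j + j0)%N) by [].
  by rewrite cvg_shiftn.
have /choice[AL hAL] : forall j, exists AL : 'M[R]_n * {vspace 'rV[R]_n},
    AL.1^T = AL.1 /\ forall t : nat -> R, decr0 t ->
    epi_cvg (fun i => diffquo2 phi (x_ j) (v_ j) (t i))
      (fun w => ((dot w (w *m AL.1))%:E + ind [set` AL.2] w)%E).
  move=> j; have [g1 g2 g3] := good' (j + j0)%N (leq_addl _ _).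
  have phix : phi (x_ j) \is a fin_num by rewrite phiy fin_numD phixbar.
  have mino := minorant _ _ g1 g2 (subd _) g3.
  have argm := prox_argmin htau htaurho phix hphi_lsc mino.
  have pfix := prox_fixed htau htaurho phix hphi_lsc mino.
  have dprox : differentiable (prox tau phi) (x_ j + tau *: v_ j).
    have [Aj _ _ Nj] := hy (j + j0)%N; have [Aj' _ Gj] := hm (j + j0)%N.
    exact: (hA (x_ j, l_ j) (conj Aj Aj') Nj Gj).
  have [A [L hL]] := prox_differentiable_epi htau phi_gtNy phix argm pfix dprox.
  by exists (A, L).
pose g_ j w := ((dot w (w *m (AL j).1))%:E + ind [set` (AL j).2] w)%E.
have gE j : subderiv2 phi (x_ j) (v_ j) = g_ j.
  by apply: subderiv2_epi => t td; have [_ h] := hAL j; exact: h.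
have epi j (t : nat -> R) : decr0 t ->
    epi_cvg (fun i => diffquo2 phi (x_ j) (v_ j) (t i)) (g_ j).
  by have [_] := hAL j; exact.
have critE w : affine_hull S w <-> w *m ('J F xbar *m cokermx V) = 0.
  rewrite mulmxA.
  exact: (affine_hull_critical Qlbar strictCQ NV spanV w).
have SE : affine_hull S = [set w | w *m ('J F xbar *m cokermx V) = 0].
  by apply/seteqP; split => w /critE.
have quadE w : affine_hull S w -> dot w (w *m QQ) = dot w (w *m hessL F xbar lbar).
  by rewrite /QQ /P SE => wS; exact: orth_proj_quadratic.
have Hc (w_ : nat -> 'rV[R]_n) w : w_ @ \oo --> w ->
    (fun j => dot (w_ j) (w_ j *m hessL F (x_ j) (l_ j))) @ \oo -->
    dot w (w *m hessL F xbar lbar).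
  by move=> ww; exact: (cvg_dot ww (cvg_mulmx ww (cvg_hessL C2F Ux xc lc))).
exists x_, v_; split.
- by move=> j; exact: subd.
- by split.
- by move=> j; exists (g_ j) => t; exact: epi.
- by move=> j; exists (AL j).1, (AL j).2; have [? _] := hAL j; split => // w; rewrite gE.
rewrite (_ : (fun j => _) = g_); last by apply/funext => j; exact: gE.
move=> w; split.
- move=> w_ ww.
  have [wS|wS] := pselect (affine_hull S w).
    rewrite /ind asboolT// adde0 quadE//.
    apply: (limn_einf_ge_cvg (Hc _ _ ww)); apply: nearW => j.
    have Qj : Q (l_ j) by have [] := Gm (j + j0)%N.
    have := second_subderiv_lower Uo C2F phixbar phiE (w_ j) (Uy _) Qj (sy _)
      (dot0l _) (tangent2_0 Qj) ltr01 (epi j).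
    by rewrite !dot0l mulr0 mul0r !addr0.
  rewrite (second_subderiv_blowup Uo Ux C2F phixbar phiE F0 cQ Qlbar spanV hpath
    xc lc (fun j => Uy _) (fun j => Ny _) (fun j => Gm _) epi ww) ?leey//.
  by move=> h; apply: wS; apply/critE; rewrite mulmxA.
- have [wS|wS] := pselect (affine_hull S w); last first.
    exists (fun=> w); first exact: cvg_cst.
    by rewrite /ind asboolF// addey// leey.
  have wC : w *m 'J F xbar *m cokermx V = 0 by rewrite -mulmxA; apply/critE.
  have [w_ ww wCj] := cvg_kernel_directions BC
    (cvg_jacobian C2F Ux (fun j => Uy (j + j0)%N) xc) wC.
  exists w_ => //; rewrite /ind asboolT// adde0 quadE//.
  apply: (limn_esup_le_cvgr (Hc _ _ ww)).
  apply: filterS wCj => j wj; have [_ yr _ Nj] := hy (j + j0)%N.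
  exact: (second_subderiv_upper Uo C2F phixbar phiE Qlbar NV spanV reg K0 yr Nj
    (Gm _) (epi j) wj).
Qed.
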